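(* Let $c\ge2$. Then $$m_{\mathrm{faithful}}(\exp(\mathfrak{m}_{2,c}\otimes_{\mathbb{Z}}\mathbb{F}_q))=(c-1)\,f\,q$$ for every $q=p^f$ with $f\ge 1$ and $p$ a prime with $p>c$.
   Context: For a finite group $G$, $m_{\mathrm{faithful}}(G)$ denotes the smallest dimension of a faithful complex representation of $G$. For a finite $\mathbb{Z}$-Lie algebra $L$ of $p$-power order, nilpotent of class less than $p$, $\exp(L)$ is the group with underlying set $L$ and multiplication given by the Baker–Campbell–Hausdorff formula $x*y=x+y+\frac12[x,y]+\cdots$ (Lazard correspondence). $\mathfrak{f}_{n,c}=\mathfrak{f}_n/\mathfrak{f}_n^{c+1}$ is the free nilpotent $\mathbb{Z}$-Lie algebra of class $c$ on $n$ generators, where $\mathfrak{f}_n$ is the free $\mathbb{Z}$-Lie algebra on $n$ generators and $\mathfrak{f}_n^{k}$ is the $k$-th term of its lower central series ($\mathfrak f_n^1=\mathfrak f_n$). The free metabelian Lie algebra of class $c$ on $n$ generators is $\mathfrak{m}_{n,c}:=\mathfrak{f}_{n,c}/[[\mathfrak{f}_{n,c},\mathfrak{f}_{n,c}],[\mathfrak{f}_{n,c},\mathfrak{f}_{n,c}]]$. *)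

(* Defs.v *)
From HB Require Import structures.
From mathcomp Require Import all_boot all_order all_algebra.
From mathcomp Require Import boolp classical_sets reals.
From mathcomp Require Export complex.

Set Implicit Arguments.
Unset Strict Implicit.
Unset Printing Implicit Defensive.

Import GRing.Theory.
Local Open Scope ring_scope.
Local Open Scope quotient_scope.

HB.mixin Record Zmodule_isLieRing L of GRing.Zmodule L := {
  lbr : L -> L -> L;
  lbrDl : forall x y z, lbr (x + y) z = lbr x z + lbr y z;
  lbrDr : forall x y z, lbr x (y + z) = lbr x y + lbr x z;
  lbrxx : forall x, lbr x x = 0;
  lbr_jacobi :
    forall x y z, lbr x (lbr y z) + lbr y (lbr z x) + lbr z (lbr x y) = 0
}.

(* Z-Lie algebras. *)
#[short(type="lieRingType")]
HB.structure Definition LieRing :=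
  {L of Zmodule_isLieRing L & GRing.Zmodule L}.

Section LieRingTheory.
Variable L : lieRingType.
Implicit Types x y z : L.

Lemma lbr0l x : lbr 0 x = 0.
Proof. by apply: (addIr (lbr 0 x)); rewrite -lbrDl !add0r. Qed.

Lemma lbr0r x : lbr x 0 = 0.
Proof. by apply: (addIr (lbr x 0)); rewrite -lbrDr !add0r. Qed.

Lemma lbrNl x y : lbr (- x) y = - lbr x y.
Proof. by apply: (addIr (lbr x y)); rewrite -lbrDl !addNr lbr0l. Qed.

Lemma lbrNr x y : lbr x (- y) = - lbr x y.
Proof. by apply: (addIr (lbr x y)); rewrite -lbrDr !addNr lbr0r. Qed.

Lemma lbrC x y : lbr x y = - lbr y x.
Proof.
have := lbrxx (x + y); rewrite lbrDl !lbrDr !lbrxx add0r addr0 => /eqP.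
by rewrite addr_eq0 => /eqP.
Qed.

Lemma lbr_leibniz x y z :
  lbr x (lbr y z) = lbr (lbr x y) z + lbr y (lbr x z).
Proof.
have := lbr_jacobi x y z; rewrite (lbrC z x) lbrNr (lbrC z (lbr x y)).
move=> /eqP; rewrite -addrA -opprD subr_eq0 addrC => /eqP ->.
by [].
Qed.

End LieRingTheory.

(* The free Lie ring on X is the type of bracket expressions in the elements of
   X, modulo the smallest congruence that makes it a Lie ring. *)

Inductive lie_term (X : Type) :=
| LGen of X
| LZero
| LOpp of lie_term X
| LAdd of lie_term X & lie_term X
| LBr of lie_term X & lie_term X.
Arguments LZero {X}.

Inductive lie_eq (X : Type) : lie_term X -> lie_term X -> Prop :=
| LE_refl s : lie_eq s s
| LE_sym s t : lie_eq s t -> lie_eq t s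
| LE_trans s t u : lie_eq s t -> lie_eq t u -> lie_eq s u
| LE_opp s s' : lie_eq s s' -> lie_eq (LOpp s) (LOpp s')
| LE_add s s' t t' :
    lie_eq s s' -> lie_eq t t' -> lie_eq (LAdd s t) (LAdd s' t')
| LE_br s s' t t' :
    lie_eq s s' -> lie_eq t t' -> lie_eq (LBr s t) (LBr s' t')
| LE_addA s t u : lie_eq (LAdd s (LAdd t u)) (LAdd (LAdd s t) u)
| LE_addC s t : lie_eq (LAdd s t) (LAdd t s)
| LE_add0 s : lie_eq (LAdd LZero s) s
| LE_addN s : lie_eq (LAdd (LOpp s) s) LZero
| LE_brDl s t u : lie_eq (LBr (LAdd s t) u) (LAdd (LBr s u) (LBr t u))
| LE_brDr s t u : lie_eq (LBr s (LAdd t u)) (LAdd (LBr s t) (LBr s u))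
| LE_brxx s : lie_eq (LBr s s) LZero
| LE_jacobi s t u :
    lie_eq (LAdd (LAdd (LBr s (LBr t u)) (LBr t (LBr u s))) (LBr u (LBr s t)))
           LZero.

HB.instance Definition _ X := gen_eqMixin (lie_term X).
HB.instance Definition _ X := gen_choiceMixin (lie_term X).

Section FreeLie.
Variable X : Type.
Local Notation term := (lie_term X).

Definition lie_eqb (s t : term) : bool := `[< lie_eq s t >].

Lemma lie_eqb_equiv : equiv_class_of lie_eqb.
Proof.
split=> [s|s t|t s u].
- exact/asboolP/LE_refl.
- by apply/asboolP/asboolP; exact: LE_sym.
- by move=> /asboolP st /asboolP tu; apply/asboolP; exact: LE_trans st tu.
Qed.

Canonical lie_eqb_rel := EquivRelPack lie_eqb_equiv.
Canonical lie_eqb_encModRel := defaultEncModRel lie_eqb.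

Definition free_lie := {eq_quot lie_eqb}.
HB.instance Definition _ : EqQuotient term lie_eqb free_lie :=
  EqQuotient.on free_lie.
HB.instance Definition _ := Choice.on free_lie.

Definition fl_pi (s : term) : free_lie := \pi_free_lie s.
Definition fl_gen (x : X) : free_lie := fl_pi (LGen x).
Definition fl_zero : free_lie := fl_pi LZero.
Definition fl_opp (a : free_lie) : free_lie := fl_pi (LOpp (repr a)).
Definition fl_add (a b : free_lie) : free_lie := fl_pi (LAdd (repr a) (repr b)).
Definition fl_br (a b : free_lie) : free_lie := fl_pi (LBr (repr a) (repr b)).

Lemma fl_piP s t : fl_pi s = fl_pi t <-> lie_eq s t.
Proof.
split=> [/eqP|st]; first by rewrite /fl_pi piE => /asboolP.
by apply/eqP; rewrite /fl_pi piE; apply/asboolP.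
Qed.

Lemma fl_repr s : lie_eq (repr (fl_pi s)) s.
Proof. by apply/fl_piP; rewrite /fl_pi reprK. Qed.

Lemma fl_ind (P : free_lie -> Prop) : (forall s, P (fl_pi s)) -> forall a, P a.
Proof. by move=> Ppi a; rewrite -[a](@reprK _ free_lie); exact: Ppi. Qed.

Lemma fl_piN s : fl_opp (fl_pi s) = fl_pi (LOpp s).
Proof. by apply/fl_piP/LE_opp/fl_repr. Qed.

Lemma fl_piD s t : fl_add (fl_pi s) (fl_pi t) = fl_pi (LAdd s t).
Proof. by apply/fl_piP/LE_add; exact: fl_repr. Qed.

Lemma fl_piB s t : fl_br (fl_pi s) (fl_pi t) = fl_pi (LBr s t).
Proof. by apply/fl_piP/LE_br; exact: fl_repr. Qed.

Lemma fl_addA : associative fl_add.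
Proof.
elim/fl_ind=> s; elim/fl_ind=> t; elim/fl_ind=> u.
by rewrite !fl_piD; apply/fl_piP/LE_addA.
Qed.

Lemma fl_addC : commutative fl_add.
Proof.
elim/fl_ind=> s; elim/fl_ind=> t.
by rewrite !fl_piD; apply/fl_piP/LE_addC.
Qed.

Lemma fl_add0 : left_id fl_zero fl_add.
Proof. by elim/fl_ind=> s; rewrite fl_piD; apply/fl_piP/LE_add0. Qed.

Lemma fl_addN : left_inverse fl_zero fl_opp fl_add.
Proof. by elim/fl_ind=> s; rewrite fl_piN fl_piD; apply/fl_piP/LE_addN. Qed.

HB.instance Definition _ :=
  GRing.isZmodule.Build free_lie fl_addA fl_addC fl_add0 fl_addN.

Lemma fl_brDl (a b c : free_lie) : fl_br (a + b) c = fl_br a c + fl_br b c.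
Proof.
elim/fl_ind: a => s; elim/fl_ind: b => t; elim/fl_ind: c => u.
rewrite /GRing.add /= !(fl_piD, fl_piB); exact/fl_piP/LE_brDl.
Qed.

Lemma fl_brDr (a b c : free_lie) : fl_br a (b + c) = fl_br a b + fl_br a c.
Proof.
elim/fl_ind: a => s; elim/fl_ind: b => t; elim/fl_ind: c => u.
rewrite /GRing.add /= !(fl_piD, fl_piB); exact/fl_piP/LE_brDr.
Qed.

Lemma fl_brxx (a : free_lie) : fl_br a a = 0.
Proof. elim/fl_ind: a => s; rewrite fl_piB; exact/fl_piP/LE_brxx. Qed.

Lemma fl_jacobi (a b c : free_lie) :
  fl_br a (fl_br b c) + fl_br b (fl_br c a) + fl_br c (fl_br a b) = 0.
Proof.
elim/fl_ind: a => s; elim/fl_ind: b => t; elim/fl_ind: c => u.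
rewrite /GRing.add /= !(fl_piD, fl_piB); exact/fl_piP/LE_jacobi.
Qed.

HB.instance Definition _ :=
  Zmodule_isLieRing.Build free_lie fl_brDl fl_brDr fl_brxx fl_jacobi.

End FreeLie.

HB.mixin Record isLieIdeal (L : lieRingType) (I : L -> bool) := {
  lie_ideal_closed : forall x y : L, y \in I -> lbr x y \in I
}.

#[short(type="lieIdeal")]
HB.structure Definition LieIdeal (L : lieRingType) :=
  {I of GRing.ZmodClosed L I & isLieIdeal L I}.

Section LieQuotient.
Variables (L : lieRingType) (I : lieIdeal L).

Definition lie_quot := Quotient.quot I.
HB.instance Definition _ := GRing.Zmodule.on lie_quot.

Definition lq_pi (x : L) : lie_quot := \pi_lie_quot x.
Definition lq_br (a b : lie_quot) : lie_quot := lq_pi (lbr (repr a) (repr b)).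

Lemma lq_piP x y : lq_pi x = lq_pi y <-> x - y \in I.
Proof. by rewrite Quotient.idealrBE; split=> [|/eqP] //; move/eqP. Qed.

Lemma lq_repr x : repr (lq_pi x) - x \in I.
Proof. by apply/lq_piP; rewrite /lq_pi reprK. Qed.

Lemma lq_ind (P : lie_quot -> Prop) : (forall x, P (lq_pi x)) -> forall a, P a.
Proof. by move=> Ppi a; rewrite -[a](@reprK _ lie_quot); exact: Ppi. Qed.

Lemma lq_piD x y : lq_pi (x + y) = lq_pi x + lq_pi y.
Proof. by rewrite /lq_pi !piE. Qed.

Lemma lq_pi0 : lq_pi 0 = 0.
Proof. by rewrite /lq_pi !piE. Qed.

Lemma lq_piB x y : lq_br (lq_pi x) (lq_pi y) = lq_pi (lbr x y).
Proof.
apply/lq_piP; set x' := repr _; set y' := repr _.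
have -> : lbr x' y' - lbr x y = lbr x' (y' - y) - lbr y (x' - x).
  by rewrite !lbrDr !lbrNr (lbrC y x') (lbrC y x) !opprD !opprK addrA subrK.
by rewrite rpredB // lie_ideal_closed // lq_repr.
Qed.

Lemma lq_brDl (a b c : lie_quot) : lq_br (a + b) c = lq_br a c + lq_br b c.
Proof.
elim/lq_ind: a => x; elim/lq_ind: b => y; elim/lq_ind: c => z.
by rewrite -lq_piD !lq_piB lbrDl lq_piD.
Qed.

Lemma lq_brDr (a b c : lie_quot) : lq_br a (b + c) = lq_br a b + lq_br a c.
Proof.
elim/lq_ind: a => x; elim/lq_ind: b => y; elim/lq_ind: c => z.
by rewrite -lq_piD !lq_piB lbrDr lq_piD.
Qed.

Lemma lq_brxx (a : lie_quot) : lq_br a a = 0.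
Proof. by elim/lq_ind: a => x; rewrite lq_piB lbrxx lq_pi0. Qed.

Lemma lq_jacobi (a b c : lie_quot) :
  lq_br a (lq_br b c) + lq_br b (lq_br c a) + lq_br c (lq_br a b) = 0.
Proof.
elim/lq_ind: a => x; elim/lq_ind: b => y; elim/lq_ind: c => z.
by rewrite !lq_piB -!lq_piD lbr_jacobi lq_pi0.
Qed.

HB.instance Definition _ :=
  Zmodule_isLieRing.Build lie_quot lq_brDl lq_brDr lq_brxx lq_jacobi.

End LieQuotient.

(* The additive subgroup generated by the brackets [x, y], x in A, y in B. *)
Inductive comm_span (L : lieRingType) (A B : {pred L}) : L -> Prop :=
| CS_br x y : x \in A -> y \in B -> comm_span A B (lbr x y)
| CS_0 : comm_span A B 0
| CS_sub x y : comm_span A B x -> comm_span A B y -> comm_span A B (x - y).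

Section Commutators.
Variable L : lieRingType.

Definition full_mem : L -> bool := fun=> true.

Lemma full_mem_zmod : zmod_closed full_mem.
Proof. by []. Qed.

Lemma full_mem_ideal (x y : L) : y \in full_mem -> lbr x y \in full_mem.
Proof. by []. Qed.

HB.instance Definition _ := GRing.isZmodClosed.Build L full_mem full_mem_zmod.
HB.instance Definition _ := isLieIdeal.Build L full_mem full_mem_ideal.

Definition lie_full : lieIdeal L := LieIdeal.clone L full_mem _.

Variables I J : lieIdeal L.

Definition comm_mem : L -> bool := fun z => `[< comm_span I J z >].

Lemma comm_mem_zmod : zmod_closed comm_mem.
Proof.
split; first exact/asboolP/CS_0.
by move=> x y /asboolP Ix /asboolP Iy; apply/asboolP/CS_sub.
Qed.

Lemma comm_mem_ideal (x y : L) : y \in comm_mem -> lbr x y \in comm_mem.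
Proof.
have [C0 CB] := comm_mem_zmod.
move=> /asboolP; elim=> {y} [y z Iy Jz||y z _ IHy _ IHz].
- rewrite lbr_leibniz -[X in _ + X]opprK; apply: (CB).
    by apply/asboolP/CS_br => //; exact: lie_ideal_closed.
  rewrite -sub0r; apply: CB => //.
  by apply/asboolP/CS_br => //; exact: lie_ideal_closed.
- by rewrite lbr0r.
- by rewrite lbrDr lbrNr; exact: CB.
Qed.

HB.instance Definition _ := GRing.isZmodClosed.Build L comm_mem comm_mem_zmod.
HB.instance Definition _ := isLieIdeal.Build L comm_mem comm_mem_ideal.

Definition lie_comm : lieIdeal L := LieIdeal.clone L comm_mem _.

End Commutators.
Arguments lie_full : clear implicits.

(* lower_central L 1 = L and lower_central L k.+1 = [lower_central L k, L];
   the index 0 is junk. *)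
Definition lower_central (L : lieRingType) (k : nat) : lieIdeal L :=
  iter k.-1 (fun I => lie_comm I (lie_full L)) (lie_full L).

Definition derived_ideal (L : lieRingType) : lieIdeal L :=
  lie_comm (lie_full L) (lie_full L).

Definition second_derived_ideal (L : lieRingType) : lieIdeal L :=
  lie_comm (derived_ideal L) (derived_ideal L).

Definition free_nilp_lie (n c : nat) : lieRingType :=
  lie_quot (lower_central (free_lie 'I_n) c.+1).

Definition free_metab_lie (n c : nat) : lieRingType :=
  lie_quot (second_derived_ideal (free_nilp_lie n c)).

(* The tensor product of M and R over Z is presented likewise: formal sums of
   pure tensors, modulo the smallest congruence that makes them an abelian group
   in which pure tensors are biadditive. *)
Inductive tens_term (M R : Type) :=
| TPure of M & R
| TZero
| TOpp of tens_term M R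
| TAdd of tens_term M R & tens_term M R.
Arguments TZero {M R}.

Inductive tens_eq (M R : zmodType) : tens_term M R -> tens_term M R -> Prop :=
| TE_refl s : tens_eq s s
| TE_sym s t : tens_eq s t -> tens_eq t s
| TE_trans s t u : tens_eq s t -> tens_eq t u -> tens_eq s u
| TE_opp s s' : tens_eq s s' -> tens_eq (TOpp s) (TOpp s')
| TE_add s s' t t' :
    tens_eq s s' -> tens_eq t t' -> tens_eq (TAdd s t) (TAdd s' t')
| TE_addA s t u : tens_eq (TAdd s (TAdd t u)) (TAdd (TAdd s t) u)
| TE_addC s t : tens_eq (TAdd s t) (TAdd t s)
| TE_add0 s : tens_eq (TAdd TZero s) s
| TE_addN s : tens_eq (TAdd (TOpp s) s) TZero
| TE_pureDl x y a :
    tens_eq (TPure (x + y) a) (TAdd (TPure x a) (TPure y a))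
| TE_pureDr x a b :
    tens_eq (TPure x (a + b)) (TAdd (TPure x a) (TPure x b)).

HB.instance Definition _ M R := gen_eqMixin (tens_term M R).
HB.instance Definition _ M R := gen_choiceMixin (tens_term M R).

Section Tensor.
Variables M R : zmodType.
Local Notation term := (tens_term M R).

Definition tens_eqb (s t : term) : bool := `[< tens_eq s t >].

Lemma tens_eqb_equiv : equiv_class_of tens_eqb.
Proof.
split=> [s|s t|t s u].
- exact/asboolP/TE_refl.
- by apply/asboolP/asboolP; exact: TE_sym.
- by move=> /asboolP st /asboolP tu; apply/asboolP; exact: TE_trans st tu.
Qed.

Canonical tens_eqb_rel := EquivRelPack tens_eqb_equiv.
Canonical tens_eqb_encModRel := defaultEncModRel tens_eqb.

Definition tensor := {eq_quot tens_eqb}.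
HB.instance Definition _ : EqQuotient term tens_eqb tensor :=
  EqQuotient.on tensor.
HB.instance Definition _ := Choice.on tensor.

Definition tn_pi (s : term) : tensor := \pi_tensor s.
Definition tens (x : M) (a : R) : tensor := tn_pi (TPure x a).
Definition tn_zero : tensor := tn_pi TZero.
Definition tn_opp (a : tensor) : tensor := tn_pi (TOpp (repr a)).
Definition tn_add (a b : tensor) : tensor := tn_pi (TAdd (repr a) (repr b)).

Lemma tn_piP s t : tn_pi s = tn_pi t <-> tens_eq s t.
Proof.
split=> [/eqP|st]; first by rewrite /tn_pi piE => /asboolP.
by apply/eqP; rewrite /tn_pi piE; apply/asboolP.
Qed.

Lemma tn_repr s : tens_eq (repr (tn_pi s)) s.
Proof. by apply/tn_piP; rewrite /tn_pi reprK. Qed.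

Lemma tn_ind (P : tensor -> Prop) : (forall s, P (tn_pi s)) -> forall a, P a.
Proof. by move=> Ppi a; rewrite -[a](@reprK _ tensor); exact: Ppi. Qed.

Lemma tn_piN_ s : tn_opp (tn_pi s) = tn_pi (TOpp s).
Proof. by apply/tn_piP/TE_opp/tn_repr. Qed.

Lemma tn_piD_ s t : tn_add (tn_pi s) (tn_pi t) = tn_pi (TAdd s t).
Proof. by apply/tn_piP/TE_add; exact: tn_repr. Qed.

Lemma tn_addA : associative tn_add.
Proof.
elim/tn_ind=> s; elim/tn_ind=> t; elim/tn_ind=> u.
by rewrite !tn_piD_; apply/tn_piP/TE_addA.
Qed.

Lemma tn_addC : commutative tn_add.
Proof.
elim/tn_ind=> s; elim/tn_ind=> t.
by rewrite !tn_piD_; apply/tn_piP/TE_addC.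
Qed.

Lemma tn_add0 : left_id tn_zero tn_add.
Proof. by elim/tn_ind=> s; rewrite tn_piD_; apply/tn_piP/TE_add0. Qed.

Lemma tn_addN : left_inverse tn_zero tn_opp tn_add.
Proof. by elim/tn_ind=> s; rewrite tn_piN_ tn_piD_; apply/tn_piP/TE_addN. Qed.

HB.instance Definition _ :=
  GRing.isZmodule.Build tensor tn_addA tn_addC tn_add0 tn_addN.

Lemma tn_piN s : tn_pi (TOpp s) = - tn_pi s.
Proof. by rewrite -tn_piN_. Qed.

Lemma tn_piD s t : tn_pi (TAdd s t) = tn_pi s + tn_pi t.
Proof. by rewrite -tn_piD_. Qed.

Lemma tensDl x y a : tens (x + y) a = tens x a + tens y a.
Proof. by rewrite -tn_piD; apply/tn_piP/TE_pureDl. Qed.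

Lemma tensDr x a b : tens x (a + b) = tens x a + tens x b.
Proof. by rewrite -tn_piD; apply/tn_piP/TE_pureDr. Qed.

Section Lift.
Variables (V : zmodType) (h : M -> R -> V).

Fixpoint tn_eval (s : term) : V :=
  match s with
  | TPure x a => h x a
  | TZero => 0
  | TOpp s => - tn_eval s
  | TAdd s t => tn_eval s + tn_eval t
  end.

Definition tn_lift (a : tensor) : V := tn_eval (repr a).

Hypothesis hDl : forall x y a, h (x + y) a = h x a + h y a.
Hypothesis hDr : forall x a b, h x (a + b) = h x a + h x b.

Lemma tn_eval_eq s t : tens_eq s t -> tn_eval s = tn_eval t.
Proof.
elim=> //= [s1 t1 u1 _ -> _ -> // | s1 s2 _ -> // | s1 s2 t1 t2 _ -> _ -> //
  | * | * | * | *].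
- exact: addrA.
- exact: addrC.
- exact: add0r.
- exact: addNr.
Qed.

Lemma tn_lift_pi s : tn_lift (tn_pi s) = tn_eval s.
Proof. exact/tn_eval_eq/tn_repr. Qed.

Lemma tn_liftD a b : tn_lift (a + b) = tn_lift a + tn_lift b.
Proof.
elim/tn_ind: a => s; elim/tn_ind: b => t.
by rewrite -tn_piD !tn_lift_pi.
Qed.

Lemma tn_lift_pure x a : tn_lift (tens x a) = h x a.
Proof. exact: tn_lift_pi. Qed.

End Lift.

Lemma tn_eval_linear (V : zmodType) (h : M -> R -> V) (g : tensor -> V) :
  {morph g : a b / a + b} -> (forall x a, g (tens x a) = h x a) ->
  forall s, g (tn_pi s) = tn_eval h s.
Proof.
move=> gD gh.
have g0 : g 0 = 0 by apply: (addIr (g 0)); rewrite -gD !add0r.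
elim=> [x a||s IHs|s IHs t IHt] /=; first exact: gh.
- exact: g0.
- rewrite tn_piN -IHs; apply: (addIr (g (tn_pi s))).
  by rewrite -gD !addNr.
- by rewrite tn_piD gD IHs IHt.
Qed.

Lemma tensor_ext (V : zmodType) (g g' : tensor -> V) :
  {morph g : a b / a + b} -> {morph g' : a b / a + b} ->
  (forall x a, g (tens x a) = g' (tens x a)) -> g =1 g'.
Proof.
move=> gD g'D gg'; elim/tn_ind=> s.
rewrite (tn_eval_linear gD (fun x a => erefl)).
by rewrite (tn_eval_linear g'D (h := fun x a => g (tens x a))).
Qed.

End Tensor.

(* The Lie bracket of M \otimes R: [x (x) a, y (x) b] = [x, y] (x) ab. *)
Section TensorLie.
Variables (M : lieRingType) (R : comNzRingType).
Local Notation MR := (tensor M R).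

Definition tn_br1 (x : M) (a : R) : MR -> MR :=
  tn_lift (fun y b => tens (lbr x y) (a * b)).

Definition tn_br (u v : MR) : MR := tn_lift (fun x a => tn_br1 x a v) u.

Lemma tn_br1_pure x a y b : tn_br1 x a (tens y b) = tens (lbr x y) (a * b).
Proof.
by apply: tn_lift_pure => *; rewrite ?(lbrDr, mulrDr) ?(tensDl, tensDr).
Qed.

Lemma tn_br1D x a : {morph tn_br1 x a : u v / u + v}.
Proof.
by apply: tn_liftD => *; rewrite ?(lbrDr, mulrDr) ?(tensDl, tensDr).
Qed.

Lemma tn_br1Dl x y a v : tn_br1 (x + y) a v = tn_br1 x a v + tn_br1 y a v.
Proof.
move: v; apply: tensor_ext => [u v|u v|z b]; rewrite ?tn_br1D //.
  by rewrite addrACA.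
by rewrite !tn_br1_pure lbrDl tensDl.
Qed.

Lemma tn_br1Dr x a b v : tn_br1 x (a + b) v = tn_br1 x a v + tn_br1 x b v.
Proof.
move: v; apply: tensor_ext => [u v|u v|z d]; rewrite ?tn_br1D //.
  by rewrite addrACA.
by rewrite !tn_br1_pure mulrDl tensDr.
Qed.

Lemma tn_brDl u v w : tn_br (u + v) w = tn_br u w + tn_br v w.
Proof. by apply: tn_liftD => *; rewrite ?tn_br1Dl ?tn_br1Dr. Qed.

Lemma tn_br_purel x a v : tn_br (tens x a) v = tn_br1 x a v.
Proof. by apply: tn_lift_pure => *; rewrite ?tn_br1Dl ?tn_br1Dr. Qed.

Lemma tn_br_pure x a y b :
  tn_br (tens x a) (tens y b) = tens (lbr x y) (a * b).
Proof. by rewrite tn_br_purel tn_br1_pure. Qed.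

Lemma tn_brDr u v w : tn_br u (v + w) = tn_br u v + tn_br u w.
Proof.
move: u; apply: tensor_ext => [s t|s t|x a]; rewrite ?tn_brDl //.
  by rewrite addrACA.
by rewrite !tn_br_purel tn_br1D.
Qed.

Lemma tn_br0r u : tn_br u 0 = 0.
Proof. by apply: (addIr (tn_br u 0)); rewrite -tn_brDr !add0r. Qed.

Lemma tn_br0l u : tn_br 0 u = 0.
Proof. by apply: (addIr (tn_br 0 u)); rewrite -tn_brDl !add0r. Qed.

Lemma tens0l a : tens 0 a = 0 :> MR.
Proof. by apply: (addIr (tens 0 a)); rewrite -tensDl !add0r. Qed.

Lemma tn_brC u v : tn_br u v = - tn_br v u.
Proof.
apply/eqP; rewrite -addr_eq0; apply/eqP; move: u.
apply: (tensor_ext (g' := fun=> 0)) => [s t|s t|x a]; rewrite ?addr0 //.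
  by rewrite tn_brDl tn_brDr addrACA.
move: v; apply: (tensor_ext (g' := fun=> 0)) => [s t|s t|y b]; rewrite ?addr0 //.
  by rewrite tn_brDl tn_brDr addrACA.
by rewrite !tn_br_pure mulrC -tensDl (lbrC y) subrr tens0l.
Qed.

Lemma tn_brxx u : tn_br u u = 0.
Proof.
elim/tn_ind: u; elim=> [x a||s IHs|s IHs t IHt].
- by rewrite -/(tens x a) tn_br_pure lbrxx tens0l.
- exact: tn_br0l.
- rewrite tn_piN; set u := tn_pi s in IHs *.
  have N v : tn_br (- u) v = - tn_br u v.
    by apply: (addIr (tn_br u v)); rewrite -tn_brDl !addNr tn_br0l.
  by rewrite N tn_brC N IHs !oppr0.
- by rewrite tn_piD tn_brDl !tn_brDr IHs IHt add0r addr0 tn_brC addNr.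
Qed.

Lemma tn_jacobi u v w :
  tn_br u (tn_br v w) + tn_br v (tn_br w u) + tn_br w (tn_br u v) = 0.
Proof.
have E (a b c a' b' c' : MR) :
    a + a' + (b + b') + (c + c') = a + b + c + (a' + b' + c').
  by rewrite (addrACA a) (addrACA (a + b)).
move: u; apply: (tensor_ext (g' := fun=> 0)) => [s t|s t|x a]; rewrite ?addr0 //.
  by rewrite !(tn_brDl, tn_brDr) E.
move: v; apply: (tensor_ext (g' := fun=> 0)) => [s t|s t|y b]; rewrite ?addr0 //.
  by rewrite !(tn_brDl, tn_brDr) E.
move: w; apply: (tensor_ext (g' := fun=> 0)) => [s t|s t|z d]; rewrite ?addr0 //.
  by rewrite !(tn_brDl, tn_brDr) E.
rewrite !tn_br_pure (mulrA b d a) (mulrC (b * d)) (mulrC d (a * b)) -(mulrA a b).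
by rewrite -!tensDl lbr_jacobi tens0l.
Qed.

HB.instance Definition _ :=
  Zmodule_isLieRing.Build (tensor M R) tn_brDl tn_brDr tn_brxx tn_jacobi.

End TensorLie.

(* x / m, when there is a unique such element (which there is if V is finite of
   order prime to m). *)
Definition nat_div (V : zmodType) (x : V) (m : nat) : V :=
  xget 0 [set y | y *+ m = x]%classic.

Section BCH.
Variables (L : lieRingType) (p : nat).
Implicit Type w : seq ('I_p * 'I_p).

(* [z_1, [z_2, [..., [z_(n-1), z_n]]]]; the value at the empty sequence is
   irrelevant. *)
Fixpoint nested_br (zs : seq L) : L :=
  match zs with
  | [::] => 0
  | [:: z] => z
  | z :: zs' => lbr z (nested_br zs')
  end.

(* For w = (r_1, s_1), ..., (r_k, s_k), the letters of x^r_1 y^s_1 ... x^r_k y^s_k. *)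
Definition bch_word (x y : L) w : seq L :=
  flatten [seq nseq rs.1 x ++ nseq rs.2 y | rs : 'I_p * 'I_p <- w].

Definition bch_degree w : nat := (\sum_(rs <- w) (rs.1 + rs.2))%N.

Definition bch_denom w : nat :=
  (size w * bch_degree w * \prod_(rs <- w) (rs.1`! * rs.2`!))%N.

(* The product x * y of exp L, by Dynkin's form of the
   Baker-Campbell-Hausdorff formula,
     sum over k >= 1 and (r_1, s_1), ..., (r_k, s_k) with all r_i + s_i > 0 of
       (-1)^(k-1) / (k * (sum_i (r_i + s_i)) * prod_i r_i! s_i!)
         * [x^r_1 y^s_1 ... x^r_k y^s_k].
   Only the terms of degree sum_i (r_i + s_i) < p are kept: when L is nilpotent
   of class less than p the others vanish, and when moreover the order of L is
   a power of the prime p the denominators of the remaining ones are invertible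
   on L. *)
Definition bch (x y : L) : L :=
  \sum_(1 <= k < p)
    \sum_(w : k.-tuple ('I_p * 'I_p) |
            all (fun rs : 'I_p * 'I_p => 0 < rs.1 + rs.2)%N w && (bch_degree w < p)%N)
      nat_div (nested_br (bch_word x y w)) (bch_denom w) *~ (-1) ^+ k.-1.

End BCH.

(* A faithful representation, over the field K and of dimension m, of the group
   with underlying set G and multiplication mul: an injective homomorphism to
   GL_m(K). *)
Definition faithful_repr (K : fieldType) (G : Type) (mul : G -> G -> G)
    (m : nat) (rho : G -> 'M[K]_m) : Prop :=
  [/\ forall g, rho g \in unitmx,
      forall g h, rho (mul g h) = rho g *m rho h
    & injective rho].

(* m is the smallest dimension of a faithful complex representation. *)
Definition is_m_faithful (R : realType) (G : Type) (mul : G -> G -> G)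
    (m : nat) : Prop :=
  (exists rho : G -> 'M[R[i]]_m, faithful_repr mul rho) /\
  (forall m' (rho : G -> 'M[R[i]]_m'), faithful_repr mul rho -> (m <= m')%N).

(* Main.v *)
From HB Require Import structures.
Require Import Defs.
From mathcomp Require Import all_boot all_order all_algebra all_field.
From mathcomp Require Import boolp classical_sets reals ring zify.

(** For each [z] in [F] there is a Lie homomorphism from [m_(2,c) (x) F_q] to a
   metabelian model on [K * K], [K = F[T]/T^c], with bracket
   [[(t, v), (t', v')] = (0, T (t v' - t' v))]: it sends [x1] to [(1, 0)] and
   [x2] to [(z, 1)], hence [ad x1^i ad x2^j [x1, x2]] to [z^j T^(i+j+1)]. The
   values [z = 0, ..., c - 2] are jointly injective, by Vandermonde.

   In the model, Dynkin's series can be summed. Its term of degree [n] is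
   [T^(n-1)] times a constant, so [d/dT] of [T] times the series removes the
   factor [1/n], and what remains is a geometric series in [exp (ad x) exp (ad y) - 1].
   Writing [e_t = exp (t T)] and [phi_t = (e_t - 1) / (t T)], the map
   [(t, v) |-> (t, phi_t v)] turns the group law into
   [(t, n) (t', n') = (t + t', n + e_t n')].

   Upper bound: for an additive character [chi] of [F], this group acts
   monomially on functions on [F], the phase at [y] being [chi] of the top
   coefficient of [e_y n]. It suffices to take [f] characters and [c - 1] values
   of [z], each contributing dimension [q].

   Lower bound: let [A] be an abelian subgroup containing the centre [Z] and
   enough elements of degree [c - 1] (for [c = 2], the multiples of [x1]). A
   faithful representation is diagonal on [A]. The nontrivial characters of [Z]
   which occur separate the points of [Z], so there are at least [(c - 1) f] of
   them; above each of them, conjugation by the multiples of [x1] or of [x2]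
   yields [q] distinct characters of [A]. *)

Set Implicit Arguments.
Unset Strict Implicit.
Unset Printing Implicit Defensive.

Import GRing.Theory.
Local Open Scope ring_scope.

(** * Inverses modulo p *)

(** A Bezout coefficient. Being a natural number, this inverse of [m] modulo [p] acts on every
    abelian group killed by [p], not only in rings of characteristic [p]. *)
Definition invp (p m : nat) : nat := (egcdn m p).1.

Lemma coprime_gt0 p m : prime p -> coprime m p -> (0 < m)%N.
Proof.
move=> p_pr; case: m => // /eqP; rewrite gcd0n => p1.
by rewrite p1 in p_pr.
Qed.

Section CharP.
Variables (K : comNzRingType) (p : nat).
Hypothesis pcharK : p \in [pchar K].
Let p_pr : prime p := pcharf_prime pcharK.

Definition natV m : K := (invp p m)%:R.

Lemma natr_natV m : coprime m p -> m%:R * natV m = 1.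
Proof.
move=> mp; rewrite /natV /invp -natrM mulnC.
case: (egcdnP p (coprime_gt0 p_pr mp)) => km kn -> _ /=.
by rewrite (eqP mp) natrD natrM (pcharf0 pcharK) mulr0 add0r.
Qed.

Lemma natVM m n : coprime m p -> coprime n p -> natV (m * n) = natV m * natV n.
Proof.
move=> mp np; have mnp : coprime (m * n) p by rewrite coprimeMl mp.
have Em := natr_natV mp; have En := natr_natV np; have := natr_natV mnp.
rewrite natrM => Emn.
transitivity (natV (m * n) * (m%:R * natV m * (n%:R * natV n))).
  by rewrite Em En !mulr1.
rewrite -[RHS]mul1r -[in RHS]Emn; ring.
Qed.

Lemma natV1 : natV 1 = 1.
Proof. by rewrite -[natV 1]mul1r -[1]/(1%:R) natr_natV // coprime1n. Qed.

Lemma natV_prod (I : Type) (s : seq I) (F : I -> nat) :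
  (forall i, coprime (F i) p) -> natV (\prod_(i <- s) F i)%N = \prod_(i <- s) natV (F i).
Proof.
move=> cF; suff [] : coprime (\prod_(i <- s) F i)%N p /\
   natV (\prod_(i <- s) F i)%N = \prod_(i <- s) natV (F i) by [].
elim: s => [|i s [IHc IH]]; first by rewrite !big_nil coprime1n natV1.
by rewrite !big_cons coprimeMl cF IHc natVM // IH.
Qed.

End CharP.

Lemma coprime_lt_prime p n : prime p -> (0 < n < p)%N -> coprime n p.
Proof.
move=> p_pr /andP[n0 np]; rewrite coprime_sym prime_coprime //.
by rewrite gtnNdvd.
Qed.

Lemma coprime_fact p n : prime p -> (n < p)%N -> coprime n`! p.
Proof.
move=> p_pr; elim: n => [|n IH] np; first by rewrite coprime1n.
by rewrite factS coprimeMl IH 1?ltnW // coprime_lt_prime.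
Qed.

(** On a group killed by [p], multiplication by [invp p m] inverts multiplication by [m]; so the
    quotient exists, is unique, and the default value of [nat_div] does not arise. *)
Lemma nat_divE (V : zmodType) p (x : V) m :
    prime p -> (forall y : V, y *+ p = 0) -> coprime m p ->
  nat_div x m = x *+ invp p m.
Proof.
move=> p_pr pV mp.
have ivK (y : V) : y *+ m *+ invp p m = y.
  rewrite -mulrnA /invp mulnC.
  case: (egcdnP p (coprime_gt0 p_pr mp)) => km kn -> _ /=.
  by rewrite (eqP mp) mulrnDr mulnC mulrnA pV mul0rn add0r.
rewrite /nat_div; case: xgetP => [y _ /= <-|/(_ (x *+ invp p m)) H].
  by rewrite ivK.
by case: H; rewrite /= mulrnAC ivK.
Qed.

(** * Polynomials modulo a power of X *)

Definition eqX (K : comNzRingType) n (a b : {poly K}) :=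
  exists q, a = b + q * 'X^n.

Section EqX.
Variable K : comNzRingType.
Implicit Types a b : {poly K}.

Lemma eqXP n a b : eqX n a b <-> forall i, (i < n)%N -> a`_i = b`_i.
Proof.
split=> [[q ->] i lin|ab]; first by rewrite coefD coefMXn lin addr0.
exists (drop_poly n (a - b)).
rewrite -{1}[a](subrK b) addrC -{1}(poly_take_drop n (a - b)).
suff -> : take_poly n (a - b) = 0 by rewrite add0r.
apply/polyP => i; rewrite coef_take_poly coef0; case: ifP => // /ab.
by rewrite coefB => ->; rewrite subrr.
Qed.

(** Turns congruences into equations in a commutative ring, where they can be rewritten and handed
    to [ring]. For n = 0 the quotient type would fall back on the modulus X. *)
Lemma eqX_qpoly n a b : (0 < n)%N ->
  eqX n a b <-> in_qpoly 'X^n a = in_qpoly 'X^n b.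
Proof.
move=> n0; have mX := mk_monic_Xn K n; rewrite prednK // in mX.
split=> [[q ->]|].
  rewrite rmorphD rmorphM /= -[RHS]addr0; congr (_ + _).
  suff -> : in_qpoly 'X^n ('X^n : {poly K}) = 0 by rewrite mulr0.
  apply/val_inj; rewrite /= mX -Pdiv.RingMonic.take_poly_rmodp.
  by rewrite -[X in take_poly _ X]mul1r take_polyMXn_0.
move=> /(congr1 val) /=; rewrite mX => ab.
have mn := @monicXn K n.
exists (Pdiv.Ring.rdivp a 'X^n - Pdiv.Ring.rdivp b 'X^n).
have := Pdiv.RingMonic.rdivp_eq mn b; have := Pdiv.RingMonic.rdivp_eq mn a.
rewrite -ab; set qa := Pdiv.Ring.rdivp a _; set qb := Pdiv.Ring.rdivp b _ => Ea Eb.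
rewrite {1}Ea mulrBl [in b + _]Eb.
ring.
Qed.

Lemma eqX_sub n m a b : (m <= n)%N -> eqX n a b -> eqX m a b.
Proof.
by move=> mn /eqXP ab; apply/eqXP => i im; apply: ab; apply: leq_trans im mn.
Qed.

Lemma eqX_comp n a b t : eqX n a b -> eqX n (a \Po (t *: 'X)) (b \Po (t *: 'X)).
Proof.
case=> q ->; exists ((t ^+ n)%:P * (q \Po (t *: 'X))).
by rewrite comp_polyD comp_polyM comp_Xn_poly exprZn -scalerAr
  mul_polyC scalerAl.
Qed.

Lemma eqX_mulX n a b : eqX n.+1 ('X * a) ('X * b) -> eqX n a b.
Proof.
by move=> /eqXP ab; apply/eqXP => i /= lin; have := ab i.+1 lin; rewrite !coefXM.
Qed.

(* Uniqueness for the linear differential equation a W' = b W, W(0) = 0. *)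
Lemma eqX_ode p a b (W : {poly K}) : p \in [pchar K] -> a`_0 = 1 -> W`_0 = 0 ->
  eqX p.-1 (a * W^`()) (b * W) -> eqX p W 0.
Proof.
move=> pK a0 W0 /eqXP ode; apply/eqXP.
have p_pr := pcharf_prime pK.
elim/ltn_ind => -[|n] IH np; rewrite coef0 //.
have np1 : (n < p.-1)%N by rewrite -ltnS prednK // prime_gt0.
(* By induction the coefficient of X^n in the equation reduces to (n + 1) W_(n+1) = 0, and n + 1 < p
   is invertible. *)
have := ode n np1; rewrite !coefM big_ord_recl /= a0 mul1r subn0 big1 => [|i _].
  rewrite addr0 big1 => [|i _]; last first.
    rewrite IH ?coef0 ?mulr0 //; have := ltn_ord i; lia.
  rewrite coef_deriv -mulr_natr => /(congr1 (fun y => y * natV K p n.+1)).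
  by rewrite mul0r -mulrA natr_natV ?mulr1 // coprime_lt_prime.
rewrite coef_deriv IH ?coef0 ?mul0rn ?mulr0 // /bump /=; have := ltn_ord i; lia.
Qed.

End EqX.

(** * Truncated exponential and logarithm *)

Section ExpLog.
Variables (K : comNzRingType) (p : nat).
Hypothesis pcharK : p \in [pchar K].
Let p_pr : prime p := pcharf_prime pcharK.
Local Notation natV := (natV K p).

(* The truncations of exp (t X) and of (exp (t X) - 1) / (t X). *)
Definition pexp (t : K) : {poly K} := \poly_(r < p) (t ^+ r * natV r`!).
Definition pphi (t : K) : {poly K} := \poly_(r < p.-1) (t ^+ r * natV r.+1`!).

Lemma p1_lt i : (i < p.-1)%N = (i.+1 < p)%N.
Proof. by rewrite -ltnS prednK // prime_gt0. Qed.

Lemma natV_fact r : (r.+1 < p)%N -> r.+1%:R * natV r.+1`! = natV r`!.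
Proof.
move=> rp; rewrite factS (natVM pcharK) ?coprime_fact ?coprime_lt_prime // 1?ltnW //.
by rewrite mulrA (natr_natV pcharK) ?mul1r // coprime_lt_prime.
Qed.

Lemma pexpE t : pexp t = 1 + t%:P * 'X * pphi t.
Proof.
apply/polyP => -[|i]; rewrite coefD coef1 -mulrA coefCM coefXM !coef_poly /=.
  by rewrite prime_gt0 // fact0 (natV1 pcharK) mulr0 addr0 mul1r.
by rewrite p1_lt add0r; case: ifP; rewrite ?mulr0 // exprS mulrA.
Qed.

Lemma pexp0E t : (pexp t)`_0 = 1.
Proof. by rewrite coef_poly prime_gt0 // fact0 (natV1 pcharK) mulr1. Qed.

Lemma pphi0E t : (pphi t)`_0 = 1.
Proof. by rewrite coef_poly p1_lt prime_gt1 // (natV1 pcharK) mulr1. Qed.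

(** Truncation costs one degree: the term of degree p - 1 on the right has no counterpart on the
    left. *)
Lemma deriv_pexp t : eqX p.-1 (pexp t)^`() (t%:P * pexp t).
Proof.
apply/eqXP => i; rewrite p1_lt => ip; rewrite coef_deriv coefCM !coef_poly ip ltnW //.
by rewrite -mulr_natl mulrCA natV_fact // exprS mulrA.
Qed.

Lemma deriv_Xpphi t : eqX p.-1 ('X * pphi t)^`() (pexp t).
Proof.
apply/eqXP => i; rewrite p1_lt => ip; rewrite coef_deriv coefXM !coef_poly p1_lt ip.
by rewrite ltnW //= -mulr_natl mulrCA natV_fact.
Qed.

Lemma p1_gt0 : (0 < p.-1)%N.
Proof. by rewrite p1_lt prime_gt1. Qed.

(** Both sides have constant term 1 and solve W' = (t + u) W modulo X^(p-1); integrating regains the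
    lost power of X. *)
Lemma pexpD t u : eqX p (pexp t * pexp u) (pexp (t + u)).
Proof.
set W := pexp t * pexp u - pexp (t + u).
suff [q Wq] : eqX p W 0.
  by exists q; rewrite -[X in _ + X]add0r -Wq /W addrC subrK.
apply: (@eqX_ode _ _ 1 (t + u)%:P) => //; first by rewrite coefC.
  by rewrite coefB coefM big_ord1 !pexp0E mulr1 subrr.
have /eqX_qpoly dt := deriv_pexp t; have /eqX_qpoly du := deriv_pexp u.
have /eqX_qpoly dtu := deriv_pexp (t + u).
apply/eqX_qpoly; rewrite ?p1_gt0 // mul1r /W derivB derivM.
rewrite !(rmorphM, rmorphB, rmorphD, polyCD) /= in dt du dtu *.
rewrite dt ?du ?dtu ?p1_gt0 //.
ring.
Qed.

(* log (1 + Y) / Y *)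
Definition plog (Y : {poly K}) := \sum_(k < p.-1) ((-1) ^+ k * natV k.+1) *: Y ^+ k.

(** This is log (exp X) = X divided by X. With Y = exp X - 1, the derivative of log (1 + Y) is Y'
    times a geometric sum in -Y; since Y' = 1 + Y, it equals 1 up to (-Y)^(p-1), a multiple of
    X^(p-1). *)
Lemma plog_pphi1 : eqX p.-1 (plog (pexp 1 - 1) * pphi 1) 1.
Proof.
set Y : {poly K} := pexp 1 - 1.
have YE : Y = 'X * pphi 1 by rewrite /Y pexpE mul1r [1 + _]addrC addrK.
apply: eqX_mulX; rewrite prednK ?prime_gt0 // mulr1.
have -> : 'X * (plog Y * pphi 1) = plog Y * Y by rewrite mulrCA -YE.
suff [q Wq] : eqX p (plog Y * Y - 'X) 0.
  by exists q; rewrite -[X in _ + X]add0r -Wq addrC subrK.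
apply: (@eqX_ode _ _ 1 0) => //; first by rewrite coefC.
  by rewrite YE mulrCA coefB coefXM coefX subrr.
have dLY : (plog Y * Y)^`() = (\sum_(k < p.-1) (- Y) ^+ k) * Y^`().
  rewrite /plog !big_distrl /= raddf_sum; apply: eq_bigr => k _.
  rewrite -scalerAl -exprSr [in RHS]exprNn.
  rewrite /= derivZ deriv_exp /= -mul_polyC -mulr_natl.
  rewrite polyCM polyC_exp polyCN.
  have kp : (k.+1 < p)%N by rewrite -p1_lt.
  have E : (natV k.+1)%:P * k.+1%:R = 1 :> {poly K}.
    by rewrite -polyC_natr -polyCM mulrC (natr_natV pcharK) // coprime_lt_prime.
  by rewrite -!mulrA (mulrA _%:P) E mul1r; congr (_ * _); rewrite mulrC.
have geo : (1 + Y) * (\sum_(k < p.-1) (- Y) ^+ k) = 1 - (- Y) ^+ p.-1.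
  by rewrite -[RHS]opprB subrX1 -mulNr; congr (_ * _); rewrite opprB opprK.
have dY : eqX p.-1 Y^`() (1 + Y).
  rewrite /Y derivB derivC subr0 addrC subrK.
  by have := deriv_pexp 1; rewrite mul1r.
rewrite mul1r mul0r derivB derivX dLY.
have {}dY : eqX p.-1 ((\sum_(k < p.-1) (- Y) ^+ k) * Y^`()) (1 - (- Y) ^+ p.-1).
  case: dY => q ->; exists ((\sum_(k < p.-1) (- Y) ^+ k) * q).
  by rewrite mulrDr mulrA -geo [_ * (1 + Y)]mulrC.
have YX : (- Y) ^+ p.-1 = (- pphi 1) ^+ p.-1 * 'X^(p.-1).
  by rewrite YE -mulrN mulrC exprMn.
case: dY => q ->; exists (q - (- pphi 1) ^+ p.-1).
by rewrite YX mulrBl addrAC [1 - _]addrC addrK add0r addrC.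
Qed.

(** Substituting t X for X in the case t = 1 avoids a division by t, which may not be invertible. *)
Lemma plog_pphi t : eqX p.-1 (plog (pexp t - 1) * pphi t) 1.
Proof.
have compE n (E : nat -> K) : (\poly_(r < n) E r) \Po (t *: 'X) = \poly_(r < n) (t ^+ r * E r).
  rewrite !poly_def rmorph_sum /=; apply: eq_bigr => i _.
  by rewrite comp_polyZ comp_Xn_poly exprZn scalerA mulrC.
have := eqX_comp t plog_pphi1.
rewrite comp_polyM comp_polyC.
have -> : pphi 1 \Po (t *: 'X) = pphi t.
  by rewrite compE; apply/polyP => i; rewrite !coef_poly expr1n mul1r.
have -> : plog (pexp 1 - 1) \Po (t *: 'X) = plog (pexp t - 1).
  rewrite /plog rmorph_sum /=; apply: eq_bigr => i _.
  rewrite comp_polyZ rmorphXn /=; congr (_ *: _ ^+ _).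
  rewrite rmorphB /= comp_polyC compE; congr (_ - _).
  by apply/polyP => j; rewrite !coef_poly expr1n mul1r.
by [].
Qed.

End ExpLog.

(** * The model Lie rings *)

(* The semidirect product of an abelian K by another abelian K: in (t, v), the
   component t acts on v as multiplication by t T. *)
Definition fil (K : comNzRingType) (T : K) : Type := (K * K)%type.

Section Fil.
Variables (K : comNzRingType) (T : K).
Local Notation fil := (fil T).
HB.instance Definition _ := GRing.Zmodule.on fil.

Definition fil_br (x y : fil) : fil := (0, T * (x.1 * y.2 - y.1 * x.2)).

Lemma fil_brDl x y z : fil_br (x + y) z = fil_br x z + fil_br y z.
Proof. by rewrite /fil_br; apply: injective_projections => /=; ring. Qed.

Lemma fil_brDr x y z : fil_br x (y + z) = fil_br x y + fil_br x z.
Proof. by rewrite /fil_br; apply: injective_projections => /=; ring. Qed.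

Lemma fil_brxx x : fil_br x x = 0.
Proof. by rewrite /fil_br; apply: injective_projections => /=; ring. Qed.

Lemma fil_jacobi x y z :
  fil_br x (fil_br y z) + fil_br y (fil_br z x) + fil_br z (fil_br x y) = 0.
Proof. by rewrite /fil_br; apply: injective_projections => /=; ring. Qed.

HB.instance Definition _ :=
  Zmodule_isLieRing.Build fil fil_brDl fil_brDr fil_brxx fil_jacobi.

Lemma fil_lbr1 (x y : fil) : (lbr x y).1 = 0. Proof. by []. Qed.

Lemma fil_lbr2 (x y : fil) : (lbr x y).2 = T * (x.1 * y.2 - y.1 * x.2).
Proof. by []. Qed.

Lemma fil_eqP (x y : fil) : x.1 = y.1 -> x.2 = y.2 -> x = y.
Proof. exact: injective_projections. Qed.

Definition fil_scale (a : K) (x : fil) : fil := (a * x.1, a * x.2).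
Local Infix "*f:" := fil_scale (at level 40).

Lemma fil_scale_is_additive a : zmod_morphism (fil_scale a).
Proof. by move=> x y; apply: fil_eqP; rewrite /= mulrBr. Qed.

HB.instance Definition _ a :=
  GRing.isZmodMorphism.Build fil fil (fil_scale a) (fil_scale_is_additive a).

Lemma fil_scaleDl a b x : (a + b) *f: x = a *f: x + b *f: x.
Proof. by apply: fil_eqP; rewrite /= mulrDl. Qed.

Lemma fil_scaleA a b x : a *f: (b *f: x) = (a * b) *f: x.
Proof. by apply: fil_eqP; rewrite /= mulrA. Qed.

Lemma fil_lbrZr a (x y : fil) : lbr x (a *f: y) = a *f: lbr x y.
Proof.
by apply: fil_eqP; rewrite ?fil_lbr1 ?fil_lbr2 /= ?fil_lbr1 ?fil_lbr2; ring.
Qed.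

Lemma fil_lbrZl a (x y : fil) : lbr (a *f: x) y = a *f: lbr x y.
Proof. by rewrite lbrC fil_lbrZr -raddfN -lbrC. Qed.

Lemma fil_sum1 (I : Type) (r : seq I) (P : pred I) (G : I -> fil) :
  (\sum_(i <- r | P i) G i).1 = \sum_(i <- r | P i) (G i).1.
Proof. exact: (raddf_sum fst). Qed.

Lemma fil_sum2 (I : Type) (r : seq I) (P : pred I) (G : I -> fil) :
  (\sum_(i <- r | P i) G i).2 = \sum_(i <- r | P i) (G i).2.
Proof. exact: (raddf_sum snd). Qed.

Lemma fil_pchar p : p \in [pchar K] -> forall x : fil, x *+ p = 0.
Proof.
move=> pK x; have [n2 n1] : (x *+ p).2 = x.2 *+ p /\ (x *+ p).1 = x.1 *+ p.
  by elim: (p) => [//|n [IH2 IH1]]; rewrite !mulrS /= IH1 IH2.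
by apply: fil_eqP; rewrite ?n1 ?n2 (mulrn_pchar pK).
Qed.

End Fil.

(** * The Baker-Campbell-Hausdorff formula in the model *)

Section Dynkin.
Variable p : nat.
Hypothesis p_pr : prime p.
Local Notation word := (seq ('I_p * 'I_p)).
Local Notation proper := (all (fun rs : 'I_p * 'I_p => 0 < rs.1 + rs.2)%N).

Lemma size_bch_word (L : lieRingType) (x y : L) (w : word) :
  size (bch_word x y w) = bch_degree w.
Proof.
rewrite /bch_word size_flatten /shape -map_comp sumnE big_map /bch_degree.
by apply: eq_bigr => rs _; rewrite /= size_cat !size_nseq.
Qed.

Lemma bch_degree_ge_size (w : word) : proper w -> (size w <= bch_degree w)%N.
Proof.
clear p_pr; rewrite /bch_degree; elim: w => [|rs w IH] /=; first by rewrite big_nil.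
by move=> /andP[rs0 /IH]; rewrite big_cons; lia.
Qed.

Lemma coprime_facts (rs : 'I_p * 'I_p) : coprime (rs.1`! * rs.2`!) p.
Proof. by rewrite coprimeMl !coprime_fact. Qed.

Lemma coprime_facts_prod (w : word) :
  coprime (\prod_(rs <- w) (rs.1`! * rs.2`!))%N p.
Proof.
elim: w => [|rs w IH]; first by rewrite big_nil coprime1n.
by rewrite big_cons coprimeMl IH coprime_facts.
Qed.

Lemma coprime_bch_denom (w : word) : (0 < size w < p)%N -> proper w ->
  (bch_degree w < p)%N -> coprime (bch_denom w) p.
Proof.
move=> sw pw dw; have := bch_degree_ge_size pw => sd.
rewrite /bch_denom !coprimeMl coprime_facts_prod !coprime_lt_prime ?sw //.
by case/andP: sw => s0 _; rewrite (leq_trans s0 sd).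
Qed.

Lemma nested_br_hom (L L' : lieRingType) (h : L -> L') (zs : seq L) :
    h 0 = 0 -> (forall x y, h (lbr x y) = lbr (h x) (h y)) ->
  h (nested_br zs) = nested_br (map h zs).
Proof. by move=> h0 hb; elim: zs => [//|z [|z' zs] IH] //=; rewrite hb IH. Qed.

(** The truncated series makes sense in any Lie ring killed by [p], nilpotent or not. Hence it can
    be computed over K[X] and then specialised. *)
Lemma bch_hom (L L' : lieRingType) (h : {additive L -> L'}) :
    (forall x y, h (lbr x y) = lbr (h x) (h y)) ->
    (forall x : L, x *+ p = 0) -> (forall x : L', x *+ p = 0) ->
  forall x y, h (bch p x y) = bch p (h x) (h y).
Proof.
move=> hb pL pL' x y; rewrite /bch raddf_sum big_nat [RHS]big_nat.
apply: eq_bigr => k /andP[k0 kp]; rewrite raddf_sum.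
apply: eq_bigr => w /andP[pw dw].
have cw : coprime (bch_denom w) p by apply: coprime_bch_denom; rewrite ?size_tuple ?k0.
rewrite (nat_divE _ p_pr pL cw) (nat_divE _ p_pr pL' cw).
rewrite raddfMz raddfMn /= nested_br_hom ?raddf0 //; congr (nested_br _ *+ _ *~ _).
rewrite /bch_word map_flatten -map_comp; congr flatten; apply: eq_map => rs /=.
by rewrite map_cat !map_nseq.
Qed.

Lemma nested_br_cat (L : lieRingType) (zs ws : seq L) : ws != [::] ->
  nested_br (zs ++ ws) = foldr (fun x u => lbr x u) (nested_br ws) zs.
Proof.
move=> ws0; elim: zs => [//|z zs IH] /=; rewrite IH.
by case: zs {IH} => [|z' zs] //=; case: ws ws0.
Qed.

Lemma foldr_nseq (A B : Type) (f : A -> B -> B) u x r :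
  foldr f u (nseq r x) = iter r (f x) u.
Proof. by elim: r => //= r ->. Qed.

Lemma big_tuple_cons (V : nmodType) (I : finType) n (P : pred (seq I)) (G : seq I -> V) :
  \sum_(w : n.+1.-tuple I | P w) G w =
  \sum_(i : I) \sum_(w : n.-tuple I | P (i :: w)) G (i :: w).
Proof.
rewrite pair_big_dep /=.
rewrite (reindex (fun iw : I * n.-tuple I => [tuple of iw.1 :: iw.2])) //=.
exists (fun w : n.+1.-tuple I => (thead w, [tuple of behead w])) => [[i w] _|w _].
  by congr (_, _) => /=; apply: val_inj.
by apply: val_inj; case/tupleP: w.
Qed.

Lemma big_tuple0 (V : nmodType) (I : finType) (P : pred (seq I)) (G : seq I -> V) :
  \sum_(w : 0.-tuple I | P w) G w = if P [::] then G [::] else 0.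
Proof.
rewrite (eq_bigl (fun w => (w == [tuple]) && P [::])); last first.
  by move=> w; rewrite tuple0 eqxx.
case: ifP => P0; last by rewrite big_pred0 // => w; rewrite andbF.
by under eq_bigl do rewrite andbT; rewrite big_pred1_eq.
Qed.

End Dynkin.

(** * Summing Dynkin's series by the number of blocks *)

Section DynkinModel.
Variables (K : comNzRingType) (p : nat).
Hypothesis pcharK : p \in [pchar K].
Let p_pr : prime p := pcharf_prime pcharK.
Let pcharP : p \in [pchar {poly K}].
Proof. by rewrite pchar_poly. Qed.
Variables t v t' v' : K.
Local Notation R := {poly K}.
Local Notation L := (fil ('X : R)).
Local Notation natVX := (natV R p).
Local Infix "*f:" := fil_scale (at level 40).
Local Notation word := (seq ('I_p * 'I_p)).
Local Notation proper := (all (fun rs : 'I_p * 'I_p => 0 < rs.1 + rs.2)%N).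
Local Notation pexp := (pexp p).
Local Notation pphi := (pphi p).
(** The coordinates are constants, so that the power of X in an iterated bracket records its
    degree. *)
Let x : L := (t%:P, v%:P).
Let y : L := (t'%:P, v'%:P).

Lemma iter_fil_br s u (z : L) r :
  iter r.+1 (lbr ((s%:P, u%:P) : L)) z =
  (0, 'X ^+ r.+1 * s%:P ^+ r * (s%:P * z.2 - z.1 * u%:P)).
Proof.
elim: r => [|r IH].
  by apply: fil_eqP; rewrite // fil_lbr2 expr0 expr1 mulr1.
rewrite iterS IH; apply: fil_eqP; rewrite // fil_lbr2 /= mul0r subr0.
by rewrite !exprS; ring.
Qed.

Lemma iter_lbr_sum (M : lieRingType) (z : M) r (I : finType) (P : pred I) (G : I -> M) :
  iter r (lbr z) (\sum_(i | P i) G i) = \sum_(i | P i) iter r (lbr z) (G i).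
Proof.
elim: r => //= r ->; elim/big_rec2: _ => [|i a b _ <-]; first exact: lbr0r.
by rewrite lbrDr.
Qed.

Lemma iter_lbr_scale (z : L) r a u : iter r (lbr z) (a *f: u) = a *f: iter r (lbr z) u.
Proof. by elim: r => //= r ->; rewrite fil_lbrZr. Qed.

(** The operator exp (ad (s, u)). After one bracket the first coordinate is 0, and from then on ad
    (s, u) multiplies by s X; the powers therefore sum to e_s and phi_s. *)
Lemma exp_fil_br s u (z : L) :
  \sum_(r < p) natVX r`! *f: iter r (lbr ((s%:P, u%:P) : L)) z =
  (z.1, pexp s * z.2 - z.1 * 'X * pphi s * u%:P).
Proof.
rewrite -(big_mkord xpredT (fun r => natVX r`! *f: iter r _ z)).
rewrite big_ltn ?prime_gt0 // big_add1 big_mkord /= fact0 (natV1 pcharP).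
under eq_bigr => r _ do rewrite -iterS iter_fil_br.
apply: fil_eqP; rewrite /= ?fil_sum1 ?fil_sum2 /= mul1r.
  by rewrite big1 ?addr0 // => r _; rewrite mulr0.
have -> : \sum_(r < p.-1) natVX r.+1`! *
    ('X ^+ r.+1 * s%:P ^+ r * (s%:P * z.2 - z.1 * u%:P)) =
    'X * pphi s * (s%:P * z.2 - z.1 * u%:P).
  rewrite /pphi poly_def big_distrr big_distrl /=; apply: eq_bigr => r _.
  rewrite -mul_polyC polyCM polyC_exp /natV polyC_natr exprS; ring.
rewrite (pexpE pcharK); ring.
Qed.

Definition bch_wt (w : word) : R := \prod_(rs <- w) (natVX rs.1`! * natVX rs.2`!).

(** The words of k blocks without sign, without the factors 1/k and 1/degree, and without the bound
    on the degree: the blocks can then be summed independently. *)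
Definition bch_layer k : L :=
  \sum_(w : k.-tuple ('I_p * 'I_p) | proper w) bch_wt w *f: nested_br (bch_word x y w).

(** The operator exp (ad x) exp (ad y) - 1 sends (a, n) to (0, [bch_eps] n - a X [bch_Q]). Moreover
    [bch_Q] is the second coordinate expected of the product, and [bch_u0] that of the one-block
    layer. *)
Definition bch_eps : R := pexp t * pexp t' - 1.
Definition bch_Q : R := pphi t * v%:P + pexp t * pphi t' * v'%:P.
Definition bch_u0 : R := v%:P + pexp t * v'%:P - t'%:P * 'X * pphi t * v%:P.

Let o0 : 'I_p := Ordinal (prime_gt0 p_pr).
Let o1 : 'I_p := Ordinal (prime_gt1 p_pr).

(** One block contributes x + exp (ad x) y: a bracket ending in two equal letters vanishes, which
    leaves s = 1, or r = 1 with s = 0. *)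
Lemma bch_layer1 : bch_layer 1 = ((t + t')%:P, bch_u0).
Proof.
rewrite /bch_layer (big_tuple_cons _ proper
  (fun w => bch_wt w *f: nested_br (bch_word x y w))).
under eq_bigr => rs _ do rewrite (big_tuple0 (fun w => proper (rs :: w))
  (fun w => bch_wt (rs :: w) *f: nested_br (bch_word x y (rs :: w)))).
transitivity (\sum_(r : 'I_p) \sum_(s : 'I_p) (natVX r`! * natVX s`!) *f:
   ((if (r == o1) && (s == o0) then x else 0) +
    (if s == o1 then iter r (lbr x) y else 0))).
  rewrite pair_bigA; apply: eq_bigr => -[r s] _ /=; rewrite andbT.
  rewrite /bch_wt big_seq1 /= /bch_word /= cats0.
  have nseq_br (z : L) n : nested_br (nseq n z) = if n == 1%N then z else 0.
    elim: n => [//|[|n] IH] //=; rewrite /= in IH; rewrite IH.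
    by case: ifP; rewrite ?lbrxx ?lbr0r.
  have -> : (r == o1) = (r == 1%N :> nat) by [].
  have -> : (s == o1) = (s == 1%N :> nat) by [].
  have -> : (s == o0) = (s == 0%N :> nat) by [].
  case: (ltnP 0 (r + s)) => [rs0|]; last first.
    rewrite leqn0 addn_eq0 => /andP[/eqP -> /eqP ->] /=.
    by rewrite addr0 raddf0.
  congr (_ *f: _); case: (nat_of_ord s) rs0 => [|n] rs0.
    by rewrite cats0 nseq_br andbT addr0.
  rewrite andbF add0r nested_br_cat // foldr_nseq nseq_br.
  case: ifP => // _; elim: (nat_of_ord r) => //= m ->; exact: lbr0r.
under eq_bigr => r _.
  rewrite (eq_bigr _ (fun s _ => raddfD (fil_scale _) _ _)) big_split /=.
  rewrite [X in _ + X](bigD1 o1) //= [X in _ + (_ + X)]big1; last first.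
    by move=> s /negPf ->; rewrite raddf0.
  rewrite addr0 [X in X + _](bigD1 o0) //= big1; last first.
    by move=> s /negPf ->; rewrite andbF raddf0.
  rewrite andbT addr0 fact0 (natV1 pcharP) mulr1.
  over.
rewrite big_split exp_fil_br (bigD1 o1) //= big1; last first.
  by move=> s /negPf ->; rewrite raddf0.
rewrite addr0; have -> : natVX (1%N)`! = 1 by rewrite (natV1 pcharP).
apply: fil_eqP; rewrite /= mul1r ?polyCD // /bch_u0; ring.
Qed.

Lemma bch_word_neq0 w : w != [::] -> proper w -> bch_word x y w != [::].
Proof.
move=> w0 /bch_degree_ge_size; rewrite -(size_bch_word x y) -!size_eq0 in w0 *.
by rewrite -!lt0n in w0 *; exact: leq_trans.
Qed.

(** Prefixing all blocks (r, s) applies exp (ad x) exp (ad y); the excluded block (0, 0) accounts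
    for the subtraction of 1. *)
Lemma bch_layerS k : bch_layer k.+2 =
  (0, bch_eps * (bch_layer k.+1).2 - (bch_layer k.+1).1 * 'X * bch_Q).
Proof.
rewrite /bch_layer (big_tuple_cons _ proper
  (fun w => bch_wt w *f: nested_br (bch_word x y w))) -/(bch_layer k.+1).
have step (rs : 'I_p * 'I_p) :
    \sum_(w : k.+1.-tuple ('I_p * 'I_p) | proper (rs :: w))
        bch_wt (rs :: w) *f: nested_br (bch_word x y (rs :: w)) =
    if (0 < rs.1 + rs.2)%N then
      (natVX rs.1`! * natVX rs.2`!) *f: iter rs.1 (lbr x) (iter rs.2 (lbr y) (bch_layer k.+1))
    else 0.
  case: ifP => rs0; last by rewrite big_pred0 // => w; rewrite /= rs0.
  rewrite /bch_layer !iter_lbr_sum raddf_sum /=.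
  apply: eq_big => [w|w]; first by rewrite rs0.
  rewrite rs0 /= => pw; rewrite !iter_lbr_scale fil_scaleA /bch_wt big_cons.
  congr (_ *f: _); rewrite /bch_word /= -catA nested_br_cat; last first.
    by rewrite -size_eq0 size_cat addn_eq0 negb_and
      (size_eq0 (flatten _)) (bch_word_neq0 _ pw) ?orbT // -size_eq0 size_tuple.
  rewrite nested_br_cat ?foldr_nseq // bch_word_neq0 // -size_eq0 size_tuple //.
rewrite (eq_bigr _ (fun rs _ => step rs)).
set N := bch_layer k.+1.
rewrite -big_mkcond /=.
transitivity (\sum_(r : 'I_p) \sum_(s : 'I_p) (natVX r`! * natVX s`!) *f:
   iter r (lbr x) (iter s (lbr y) N) - N).
  rewrite pair_bigA /= [in RHS](bigD1 (o0, o0)) //= !fact0 (natV1 pcharP) mulr1.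
  have -> : 1 *f: N = N by apply: fil_eqP; rewrite /= mul1r.
  rewrite addrC addrK; apply: eq_bigl => -[r s] /=.
  by rewrite lt0n addn_eq0 xpair_eqE.
have -> : \sum_(r : 'I_p) \sum_(s : 'I_p) (natVX r`! * natVX s`!) *f:
    iter r (lbr x) (iter s (lbr y) N) =
    \sum_(r < p) natVX r`! *f: iter r (lbr x)
      (\sum_(s < p) natVX s`! *f: iter s (lbr y) N).
  apply: eq_bigr => r _; rewrite iter_lbr_sum raddf_sum; apply: eq_bigr => s _.
  by rewrite /= iter_lbr_scale fil_scaleA.
rewrite !exp_fil_br; apply: fil_eqP; rewrite /= ?subrr // /bch_eps /bch_Q; ring.
Qed.

Lemma bch_layerSS k : bch_layer k.+2 =
  (0, bch_eps ^+ k * (bch_eps * bch_u0 - (t + t')%:P * 'X * bch_Q)).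
Proof.
elim: k => [|k IH]; rewrite bch_layerS ?bch_layer1 ?IH /=.
  by rewrite expr0 mul1r.
by rewrite !mul0r subr0 exprS mulrA.
Qed.

Definition bch_coef k : R := (-1) ^+ k.-1 * natVX k.

Lemma bch_term k (w : k.-tuple ('I_p * 'I_p)) (z : L) :
    (0 < k < p)%N -> proper w -> (bch_degree w < p)%N ->
  nat_div z (bch_denom w) *~ (-1) ^+ k.-1 =
  (bch_coef k * natVX (bch_degree w) * bch_wt w) *f: z.
Proof.
move=> kp pw dw; have cw : coprime (bch_denom w) p.
  by apply: (coprime_bch_denom p_pr) => //; rewrite size_tuple.
rewrite (nat_divE z p_pr (fil_pchar pcharP (T := 'X)) cw).
have -> : z *+ invp p (bch_denom w) = natVX (bch_denom w) *f: z.
  have E n : (z *+ n).2 = n%:R * z.2 /\ (z *+ n).1 = n%:R * z.1.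
    elim: n => [|n [IH2 IH1]]; first by rewrite !mulr0n !mul0r.
    by rewrite !mulrS !mulrDl /= IH1 IH2 !mul1r.
  by have [E2 E1] := E (invp p (bch_denom w)); apply: fil_eqP; rewrite /= ?E1 ?E2.
have -> (u : L) : u *~ (-1) ^+ k.-1 = ((-1) ^+ k.-1) *f: u.
  elim: k.-1 => [|n IH]; first by apply: fil_eqP; rewrite !expr0 mulr1z /= mul1r.
  by rewrite !exprS !mulN1r mulrNz IH; apply: fil_eqP; rewrite /= mulNr.
rewrite fil_scaleA; congr (_ *f: _); rewrite /bch_denom size_tuple.
have d0 : (0 < bch_degree w < p)%N.
  rewrite dw andbT (leq_trans _ (bch_degree_ge_size pw)) // size_tuple.
  by case/andP: kp.
rewrite !(natVM pcharP) ?coprimeMl ?coprime_facts_prod ?coprime_lt_prime //.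
rewrite (natV_prod pcharP); last by move=> rs; apply: coprime_facts.
rewrite /bch_coef /bch_wt -!mulrA; congr (_ * (_ * (_ * _))).
by apply: eq_bigr => rs _; rewrite (natVM pcharP) // coprime_fact.
Qed.

Lemma nested_br1 (zs : seq L) : size zs != 1%N -> (nested_br zs).1 = 0.
Proof. by case: zs => [|z [|z' zs]]. Qed.

(** Each bracket brings exactly one factor X, so degree n yields a constant times X^(n-1). *)
Lemma nested_br2 (zs : seq L) : (forall z, z \in zs -> exists c d, z = (c%:P, d%:P)) ->
  exists a, (nested_br zs).2 = a%:P * 'X^((size zs).-1).
Proof.
elim: zs => [_|z zs IH czs]; first by exists 0; rewrite mul0r.
have [c [d zE]] := czs z (mem_head _ _).
case: zs => [|z' zs] in IH czs *; first by exists d; rewrite zE expr0 mulr1.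
have {}IH : exists a, (nested_br (z' :: zs)).2 = a%:P * 'X^(size zs).
  by apply: IH => u uz; apply: czs; rewrite inE uz orbT.
have [c' [d' zE']] : exists c d, z' = (c%:P, d%:P).
  by apply: czs; rewrite !inE eqxx orbT.
case: IH => a Ea; rewrite -[nested_br _]/(lbr z (nested_br (z' :: zs))) fil_lbr2 Ea.
rewrite -[(size (z :: z' :: zs)).-1]/(size zs).+1 exprS zE /=.
case: zs => [|z'' zs] in czs Ea *.
  exists (c * a - c' * d); rewrite polyCB !polyCM zE' /= expr0; ring.
by exists (c * a); rewrite fil_lbr1 mul0r subr0 polyCM; ring.
Qed.

Lemma bch_word_const (w : word) z : z \in bch_word x y w -> exists c d, z = (c%:P, d%:P).
Proof.
case/flattenP => s /mapP [rs _ ->]; rewrite mem_cat => /orP[] /nseqP[-> _].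
  by exists t, v.
by exists t', v'.
Qed.

Lemma bch_layers1 : (bch p x y).1 = \sum_(1 <= k < p) bch_coef k * (bch_layer k).1.
Proof.
rewrite /bch fil_sum1 big_nat [RHS]big_nat; apply: eq_bigr => k kp.
rewrite fil_sum1 /bch_layer fil_sum1 big_distrr /= big_mkcondr /=.
apply: eq_bigr => w pw; case: ifP => dw.
  rewrite bch_term //=; case: (eqVneq (bch_degree w) 1%N) => [->|d1].
    by rewrite (natV1 pcharP); ring.
  by rewrite nested_br1 ?size_bch_word // !mulr0.
rewrite nested_br1 ?mulr0 // size_bch_word; apply: contraFneq dw => ->.
exact: prime_gt1.
Qed.

Lemma eqX_sum n (I : Type) (r : seq I) (P : pred I) (F G : I -> R) :
  (forall i, P i -> eqX n (F i) (G i)) ->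
  eqX n (\sum_(i <- r | P i) F i) (\sum_(i <- r | P i) G i).
Proof.
move=> FG; elim/big_rec2: _ => [|i a b Pi [q ->]]; first by exists 0; rewrite mul0r addr0.
by have [q' ->] := FG i Pi; exists (q' + q); rewrite mulrDl addrACA.
Qed.

Lemma bch_wtE (w : word) : exists a, bch_wt w = a%:P.
Proof.
rewrite /bch_wt; elim: w => [|rs w [a E]]; first by exists 1; rewrite big_nil.
rewrite big_cons E /natV -!polyC_natr -!polyCM; by eexists.
Qed.

(* The factor 1 / degree of Dynkin's formula disappears on differentiating. *)
Lemma bch_layers2 : eqX p.-1 ('X * (bch p x y).2)^`()
  (\sum_(1 <= k < p) bch_coef k * (bch_layer k).2).
Proof.
rewrite /bch fil_sum2 big_distrr raddf_sum big_nat [X in eqX _ _ X]big_nat.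
apply: eqX_sum => k kp; rewrite fil_sum2 /bch_layer fil_sum2 !big_distrr raddf_sum /=.
rewrite big_mkcondr /=; apply: eqX_sum => w pw.
have [a Ea] := nested_br2 (@bch_word_const w); rewrite size_bch_word in Ea.
have [b Eb] := bch_wtE w; have [e Ee] : exists e, bch_coef k = e%:P.
  by exists ((-1) ^+ k.-1 * natV K p k); rewrite polyCM polyC_exp polyCN /natV polyC_natr.
have d0 : (0 < bch_degree w)%N.
  rewrite (leq_trans _ (bch_degree_ge_size pw)) // size_tuple.
  by case/andP: kp.
(* The layers also contain words of degree at least p, absent from [bch]; their brackets are
   multiples of X^(p-1). *)
case: ifP => dw; last first.
  exists (- (e%:P * (b%:P * (a%:P * 'X^(bch_degree w - p))))); rewrite Ea Eb Ee.
  have -> : (bch_degree w).-1 = ((bch_degree w - p) + p.-1)%N.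
    by have := prime_gt0 p_pr; lia.
  by rewrite exprD; ring.
exists 0; rewrite mul0r addr0 bch_term //= Ea Eb Ee.
have -> : 'X * (e%:P * natVX (bch_degree w) * b%:P * (a%:P * 'X^((bch_degree w).-1))) =
    (e * natV K p (bch_degree w) * b * a) *: 'X^(bch_degree w).
  have -> : 'X^(bch_degree w) = 'X * 'X^((bch_degree w).-1) :> R by rewrite -exprS prednK.
  rewrite -mul_polyC !polyCM /natV polyC_natr; ring.
rewrite derivZ derivXn -mulr_natl -mul_polyC !polyCM.
have E : (natV K p (bch_degree w))%:P * (bch_degree w)%:R = 1 :> R.
  rewrite /natV polyC_natr mulrC; apply: (natr_natV pcharP).
  by rewrite coprime_lt_prime ?d0.
transitivity (e%:P * ((natV K p (bch_degree w))%:P * (bch_degree w)%:R) *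
  (b%:P * (a%:P * 'X^((bch_degree w).-1)))); first by ring.
by rewrite E mulr1.
Qed.

Lemma bch_model1 : (bch p x y).1 = (t + t')%:P.
Proof.
rewrite bch_layers1 big_ltn ?prime_gt1 // bch_layer1 big_nat big1 ?addr0.
  by rewrite /bch_coef (natV1 pcharP) expr0 !mul1r.
by case=> [|[|k]] // _; rewrite bch_layerSS mulr0.
Qed.

End DynkinModel.

(* Dynkin's series D and the candidate T Q / e have the same derivative. *)
Lemma bch_ode_identity (A : comNzRingType)
    (T t t' v v' B Pt Pt' e l l2 eps Et Et' DB dEt dXPt dXPt' de : A) :
  let g := t + t' in let Q := Pt * v + Et * Pt' * v' in
  DB = l * (v + Et * v' - t' * T * Pt * v) - l2 * (g * T * Q) ->
  l * e = 1 -> l = 1 + l2 * eps -> eps = g * T * e ->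
  Et = 1 + t * T * Pt -> Et' = 1 + t' * T * Pt' -> Et * Et' = 1 + g * T * e ->
  dEt = t * Et -> dXPt = Et -> dXPt' = Et' -> e + T * de = 1 + g * T * e ->
  e * (de * (T * B) + e * DB - (dXPt * v + (dEt * (T * Pt') + Et * dXPt') * v')) =
  de * (e * (T * B) - T * Q).
Proof.
move=> g Q hD le lS epsE hEt hEt' hEE -> -> -> hde.
(* Multiplying by e^2 turns l e into 1 and l2 g T e into l - 1, which eliminates both series. *)
have hDB : e * e * DB = e * (v + Et * v' - t' * T * Pt * v) - Q * (l * e - e).
  rewrite hD [in RHS]lS epsE; set u0 := v + _ - _.
  transitivity ((l * e) * e * u0 - Q * e * (l2 * (g * T * e))); first by ring.
  by rewrite le; ring.
have hTde : T * de = 1 + g * T * e - e by rewrite -hde addrC addKr.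
apply/eqP; rewrite -subr_eq0; apply/eqP.
transitivity (e * e * DB - e * (Et * v + (t * Et * (T * Pt') + Et * Et') * v')
   + (T * de) * Q); first by ring.
by rewrite hDB hTde le /Q hEt' /g; rewrite hEt; ring.
Qed.

(** * The group law in the model *)

Section BCHModel.
Variables (K : comNzRingType) (p : nat).
Hypothesis pcharK : p \in [pchar K].
Let p_pr : prime p := pcharf_prime pcharK.
Let pcharP : p \in [pchar {poly K}].
Proof. by rewrite pchar_poly. Qed.
Local Notation pexp := (pexp p).
Local Notation pphi := (pphi p).

(** The first term is split off because only the layers with at least two blocks are geometric. *)
Lemma plog_split (Y : {poly K}) :
  plog p Y = 1 + (\sum_(0 <= k < p.-2) bch_coef K p k.+2 * Y ^+ k) * Y.
Proof.
rewrite /plog -(big_mkord xpredT (fun k => ((-1) ^+ k * natV K p k.+1) *: Y ^+ k)).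
rewrite big_ltn ?(p1_gt0 pcharK) // big_add1 expr0 mul1r (natV1 pcharK) expr0 scale1r.
congr (_ + _); rewrite big_distrl /=; apply: eq_bigr => k _.
rewrite /bch_coef /= -mul_polyC polyCM polyC_exp polyCN /natV polyC_natr !exprSr.
by ring.
Qed.

Lemma bch_layers_sum t v t' v' :
  \sum_(1 <= k < p) bch_coef K p k * (bch_layer p t v t' v' k).2 =
  plog p (bch_eps p t t') * bch_u0 p t v t' v' -
  (\sum_(0 <= k < p.-2) bch_coef K p k.+2 * bch_eps p t t' ^+ k) *
  ((t + t')%:P * 'X * bch_Q p t v t' v').
Proof.
rewrite plog_split big_ltn ?prime_gt1 // (bch_layer1 pcharK).
rewrite /bch_coef (natV1 pcharP) expr0 !mul1r /=.
rewrite (_ : 2 = 0 + 2)%N // big_addn subn2.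
have -> : \sum_(0 <= k < p.-2) bch_coef K p (k + 2) * (bch_layer p t v t' v' (k + 2)).2 =
    (\sum_(0 <= k < p.-2) bch_coef K p k.+2 * bch_eps p t t' ^+ k) *
    (bch_eps p t t' * bch_u0 p t v t' v' - (t + t')%:P * 'X * bch_Q p t v t' v').
  rewrite big_distrl /=; apply: eq_bigr => k _.
  by rewrite addn2 (bch_layerSS pcharK) /= mulrA.
rewrite /bch_coef; ring.
Qed.

Lemma eqX_plog n (a b : {poly K}) : (0 < n)%N -> eqX n a b -> eqX n (plog p a) (plog p b).
Proof.
move=> n0 /eqX_qpoly ab; apply/eqX_qpoly => //; rewrite /plog !rmorph_sum /=.
by apply: eq_bigr => k _; rewrite -!mul_polyC !rmorphM !rmorphXn /= ab.
Qed.

(** For W = phi_g X B - X Q, the claim amounts to W = 0 modulo X^p. The series W / phi_g is X B - X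
    Q / phi_g, whose derivative vanishes; with denominators cleared this reads phi_g W' = phi_g'
    W. *)
Lemma bch_model2 t v t' v' : eqX p.-1 (pphi (t + t') *
    (bch p ((t%:P, v%:P) : fil ('X : {poly K})) ((t'%:P, v'%:P) : fil ('X : {poly K}))).2)
  (bch_Q p t v t' v').
Proof.
set B := (X in pphi _ * X); set g := t + t'; set Q := bch_Q p t v t' v'.
pose W := pphi g * ('X * B) - 'X * Q.
have p1 := p1_gt0 pcharK.
suff [q Wq] : eqX p W 0.
  apply: eqX_mulX; rewrite prednK ?prime_gt0 //; exists q.
  by rewrite add0r in Wq; rewrite mulrCA -Wq /W addrC subrK.
apply: (@eqX_ode _ _ (pphi g) (pphi g)^`()) => //; first exact: pphi0E.
  by rewrite /W coefB mulrCA !coefXM subrr.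
have toq (a b : {poly K}) : eqX p.-1 a b -> in_qpoly 'X^(p.-1) a = in_qpoly 'X^(p.-1) b.
  exact: (eqX_qpoly a b p1).1.
have qM a b : in_qpoly 'X^(p.-1) (a * b : {poly K}) = in_qpoly 'X^(p.-1) a * in_qpoly 'X^(p.-1) b.
  exact: rmorphM.
have qD a b : in_qpoly 'X^(p.-1) (a + b : {poly K}) = in_qpoly 'X^(p.-1) a + in_qpoly 'X^(p.-1) b.
  exact: rmorphD.
have qB a b : in_qpoly 'X^(p.-1) (a - b : {poly K}) = in_qpoly 'X^(p.-1) a - in_qpoly 'X^(p.-1) b.
  exact: rmorphB.
have qN a : in_qpoly 'X^(p.-1) (- a : {poly K}) = - in_qpoly 'X^(p.-1) a.
  exact: rmorphN.
have q1 : in_qpoly 'X^(p.-1) (1 : {poly K}) = 1 by exact: rmorph1.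
have leX (a b : {poly K}) : eqX p a b -> eqX p.-1 a b by apply: eqX_sub; exact: leq_pred.
have /toq hD := bch_layers2 pcharK t v t' v'; rewrite -/B in hD.
rewrite bch_layers_sum -/g -/Q in hD.
have eE : eqX p.-1 (bch_eps p t t') (g%:P * 'X * pphi g).
  have -> : g%:P * 'X * pphi g = pexp g - 1 by rewrite (pexpE pcharK) addrC addKr.
  case: (leX _ _ (pexpD pcharK t t')) => q E.
  by exists q; rewrite /bch_eps E addrAC.
have /toq lE : eqX p.-1 (plog p (bch_eps p t t') * pphi g) 1.
  have /toq E1 := plog_pphi pcharK g; have /toq E2 := eqX_plog p1 eE.
  apply/eqX_qpoly => //; rewrite qM E2 -E1 qM.
  by congr (in_qpoly _ (plog p _) * _); rewrite (pexpE pcharK) addrC addKr.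
have lS := congr1 (in_qpoly 'X^(p.-1)) (plog_split (bch_eps p t t')).
have /toq {}eE := eE.
have /toq EE := leX _ _ (pexpD pcharK t t').
have /toq dt := deriv_pexp pcharK t.
have /toq dpt := deriv_Xpphi pcharK t.
have /toq dpt' := deriv_Xpphi pcharK t'.
have /toq dpg := deriv_Xpphi pcharK g.
have dW : W^`() = (pphi g)^`() * ('X * B) + pphi g * ('X * B)^`() -
    (('X * pphi t)^`() * v%:P + ((pexp t)^`() * ('X * pphi t') +
      pexp t * ('X * pphi t')^`()) * v'%:P).
  rewrite /W derivB; congr (_ - _); first by rewrite (derivM (pphi g)).
  have -> : 'X * Q = ('X * pphi t) * v%:P + (pexp t * ('X * pphi t')) * v'%:P.
    by rewrite /Q /bch_Q; ring.
  by rewrite derivD !(derivM _ _%:P) !derivC !mulr0 !addr0 (derivM (pexp t)).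
have ht := congr1 (in_qpoly 'X^(p.-1)) (pexpE pcharK t).
have ht' := congr1 (in_qpoly 'X^(p.-1)) (pexpE pcharK t').
have hg := congr1 (in_qpoly 'X^(p.-1)) (pexpE pcharK g).
rewrite derivM derivX mul1r in dpg.
have gE : g%:P = t%:P + t'%:P :> {poly K} by rewrite polyCD.
apply/eqX_qpoly => //; rewrite dW /W.
move: hD lE lS eE; move: (bch_eps p t t') => eps.
move: (\sum_(0 <= k < p.-2) _) => l2; move: (plog p eps) => l.
move: EE; rewrite -/g /Q /bch_Q /bch_u0 hg => EE hD lE lS eE.
move: hD lE lS eE EE dt dpt dpt' dpg ht ht'; rewrite hg gE !(qB, qD, qM, qN) q1.
move=> hD lE lS eE EE dt dpt dpt' dpg ht ht'.
pose q := in_qpoly ('X^(p.-1) : {poly K}).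
exact: (@bch_ode_identity _ (q 'X) (q t%:P) (q t'%:P) (q v%:P) (q v'%:P) (q B)
  (q (pphi t)) (q (pphi t')) (q (pphi g)) (q l) (q l2) (q eps) (q (pexp t))
  (q (pexp t')) (q ('X * B)^`()) (q (pexp t)^`()) (q ('X * pphi t)^`())
  (q ('X * pphi t')^`()) (q (pphi g)^`()) hD lE lS eE ht ht' EE dt dpt dpt' dpg).
Qed.

Lemma horner_eqX (T : K) n (a b : {poly K}) : T ^+ n = 0 -> eqX n a b -> a.[T] = b.[T].
Proof. by move=> T0 [q ->]; rewrite hornerD hornerM hornerXn T0 mulr0 addr0. Qed.

(** Evaluation at T maps the constant elements of the model over K[X] onto the given ones, and
    T^(p-1) = 0 turns the congruence into an equality. *)
Theorem bch_fil (T : K) (x y : fil T) : T ^+ p.-1 = 0 ->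
  (bch p x y).1 = x.1 + y.1 /\
  (pphi (x.1 + y.1)).[T] * (bch p x y).2 =
    (pphi x.1).[T] * x.2 + (pexp x.1).[T] * (pphi y.1).[T] * y.2.
Proof.
move=> T0; case: x y => [t v] [t' v'] /=.
pose h (z : fil ('X : {poly K})) : fil T := (z.1.[T], z.2.[T]).
have hadd : zmod_morphism h.
  by move=> z1 z2; apply: fil_eqP; rewrite /= hornerD hornerN.
pose hA := GRing.isZmodMorphism.Build _ _ h hadd.
pose H : {additive fil ('X : {poly K}) -> fil T} := HB.pack h hA.
have hE : h (bch p ((t%:P, v%:P) : fil ('X : {poly K})) ((t'%:P, v'%:P) : fil ('X : {poly K})))
    = bch p ((t, v) : fil T) ((t', v') : fil T).
  have -> : ((t, v) : fil T) = H (t%:P, v%:P) by rewrite /H /= /h /= !hornerC.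
  have -> : ((t', v') : fil T) = H (t'%:P, v'%:P) by rewrite /H /= /h /= !hornerC.
  apply: (bch_hom p_pr (h := H)); last 2 first.
  - exact: fil_pchar.
  - exact: fil_pchar.
  move=> z1 z2; apply: fil_eqP; rewrite /= ?horner0 //.
  by rewrite !(hornerM, hornerD, hornerN, hornerX).
rewrite -hE /h /= (bch_model1 pcharK) hornerC; split=> //.
rewrite -hornerM (horner_eqX T0 (bch_model2 t v t' v')) /bch_Q.
by rewrite !(hornerM, hornerD, hornerC).
Qed.

End BCHModel.

(** * Homomorphisms to the models *)

Definition lie_hom (L L' : lieRingType) (h : L -> L') : Prop :=
  (forall x y, h (x + y) = h x + h y) /\ (forall x y, h (lbr x y) = lbr (h x) (h y)).

Section LieHom.
Variables (L L' : lieRingType) (h : L -> L').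
Hypothesis hh : lie_hom h.

Lemma lie_hom0 : h 0 = 0.
Proof. by apply: (addIr (h 0)); rewrite -hh.1 !add0r. Qed.

Lemma lie_homN x : h (- x) = - h x.
Proof. by apply: (addIr (h x)); rewrite -hh.1 !addNr lie_hom0. Qed.

Lemma lie_homB x y : h (x - y) = h x - h y.
Proof. by rewrite hh.1 lie_homN. Qed.

Lemma comm_span_hom (A B : {pred L}) (P : L' -> Prop) z : comm_span A B z ->
  P 0 -> (forall x y, P x -> P y -> P (x - y)) ->
  (forall x y, x \in A -> y \in B -> P (lbr (h x) (h y))) -> P (h z).
Proof.
move=> + P0 PB Pbr; elim=> {z} [x y xA yB||x y _ IHx _ IHy].
- by rewrite hh.2; apply: Pbr.
- by rewrite lie_hom0.
- by rewrite lie_homB; apply: PB.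
Qed.

Section LiftQuot.
Variable I : lieIdeal L.
Hypothesis hI : forall x, x \in I -> h x = 0.

Definition lq_lift (a : lie_quot I) : L' := h (repr a).

Lemma lq_lift_pi x : lq_lift (lq_pi I x) = h x.
Proof.
by apply/eqP; rewrite -subr_eq0 -lie_homB; apply/eqP/hI/lq_repr.
Qed.

Lemma lq_lift_hom : lie_hom lq_lift.
Proof.
split; elim/lq_ind=> x; elim/lq_ind=> y.
  by rewrite -lq_piD !lq_lift_pi hh.1.
by rewrite /lbr /= lq_piB !lq_lift_pi hh.2.
Qed.

End LiftQuot.
End LieHom.

Section LiftFree.
Variables (X : Type) (L : lieRingType) (g : X -> L).

Fixpoint lt_eval (s : lie_term X) : L :=
  match s with
  | LGen x => g x
  | LZero => 0
  | LOpp s => - lt_eval s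
  | LAdd s t => lt_eval s + lt_eval t
  | LBr s t => lbr (lt_eval s) (lt_eval t)
  end.

Lemma lt_eval_eq s t : lie_eq s t -> lt_eval s = lt_eval t.
Proof.
elim=> //= [s1 t1 u1 _ -> _ -> // | s1 s2 _ -> // | s1 s2 t1 t2 _ -> _ -> //
  | s1 s2 t1 t2 _ -> _ -> // | * | * | * | * | * | * | * | *].
- exact: addrA.
- exact: addrC.
- exact: add0r.
- exact: addNr.
- exact: lbrDl.
- exact: lbrDr.
- exact: lbrxx.
- exact: lbr_jacobi.
Qed.

Definition fl_lift (a : free_lie X) : L := lt_eval (repr a).

Lemma fl_lift_pi s : fl_lift (fl_pi s) = lt_eval s.
Proof. exact/lt_eval_eq/fl_repr. Qed.

Lemma fl_lift_hom : lie_hom fl_lift.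
Proof.
split; elim/fl_ind=> s; elim/fl_ind=> t.
  by rewrite -[fl_pi s + _]/(fl_add _ _) fl_piD !fl_lift_pi.
by rewrite -[lbr (fl_pi s) _]/(fl_br _ _) fl_piB !fl_lift_pi.
Qed.

End LiftFree.

Section Model.
Variables (K : comNzRingType) (T : K) (c : nat).
Hypotheses (c0 : (0 < c)%N) (Tc : T ^+ c = 0).
Local Infix "*f:" := fil_scale (at level 40).

(** Each bracket brings one factor T, so the term of index c + 1 is killed by T^c = 0. The first
    coordinate vanishes only from the second term on. *)
Lemma lower_central_fil (L : lieRingType) (h : L -> fil T) k x : lie_hom h ->
  x \in lower_central L k.+1 -> ((0 < k)%N -> (h x).1 = 0) /\ exists b, (h x).2 = T ^+ k * b.
Proof.
move=> hh; elim: k x => [|k IH] x.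
  by move=> _; split=> //; exists (h x).2; rewrite expr0 mul1r.
move=> /asboolP; move=> xk.
suff [h1 h2] : (h x).1 = 0 /\ exists b, (h x).2 = T ^+ k.+1 * b by split.
apply: (comm_span_hom (P := fun u : fil T => u.1 = 0 /\ exists b, u.2 = T ^+ k.+1 * b) hh xk).
- by split=> //; exists 0; rewrite mulr0.
- move=> u v [u1 [b ub]] [v1 [d vd]]; split; first by rewrite /= u1 v1 subrr.
  by exists (b - d); rewrite /= ub vd mulrBr.
move=> y w yk _; split=> //; rewrite fil_lbr2.
have [y1 [b ->]] := IH y yk; case: k {IH xk} yk y1 => [_ _|k _ ->//].
  by rewrite expr1; eexists.
by rewrite mul0r sub0r; exists (- ((h w).1 * b)); rewrite !exprS; ring.
Qed.

Lemma derived_ideal_fil (L : lieRingType) (h : L -> fil T) x : lie_hom h ->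
  x \in derived_ideal L -> (h x).1 = 0.
Proof.
move=> hh /asboolP xd; apply: (comm_span_hom (P := fun u : fil T => u.1 = 0) hh xd) => //.
by move=> u v /= -> ->; rewrite subrr.
Qed.

Lemma second_derived_fil (L : lieRingType) (h : L -> fil T) x : lie_hom h ->
  x \in second_derived_ideal L -> h x = 0.
Proof.
move=> hh /asboolP xd; apply: (comm_span_hom (P := fun u : fil T => u = 0) hh xd) => //.
  by move=> u v -> ->; rewrite subrr.
move=> u v ud vd; apply: fil_eqP => //; rewrite fil_lbr2.
by rewrite !(derived_ideal_fil hh) // !mul0r subrr mulr0.
Qed.

Variable z : K.

Definition model_gen (i : 'I_2) : fil T := if i == ord0 then (1, 0) else (z, 1).

Definition model_nilp : free_nilp_lie 2 c -> fil T :=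
  lq_lift (fl_lift model_gen) (I := lower_central _ c.+1).

Definition model_metab : free_metab_lie 2 c -> fil T :=
  lq_lift model_nilp (I := second_derived_ideal _).

Lemma lower_central_model x :
  x \in lower_central (free_lie 'I_2) c.+1 -> fl_lift model_gen x = 0.
Proof.
move=> xc; have [h1 [b h2]] := lower_central_fil (fl_lift_hom model_gen) xc.
by apply: fil_eqP; rewrite ?h1 // h2 Tc mul0r.
Qed.

Lemma model_nilp_hom : lie_hom model_nilp.
Proof. refine (lq_lift_hom (fl_lift_hom _) lower_central_model). Qed.

Lemma model_metab_hom : lie_hom model_metab.
Proof.
refine (lq_lift_hom model_nilp_hom _) => x.
exact/second_derived_fil/model_nilp_hom.
Qed.

Lemma model_metab_pi s : model_metab (lq_pi _ (lq_pi _ (fl_pi s))) = lt_eval model_gen s.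
Proof.
rewrite /model_metab lq_lift_pi; last 2 first.
- exact: model_nilp_hom.
- by move=> x; apply/second_derived_fil/model_nilp_hom.
rewrite /model_nilp lq_lift_pi; last 2 first.
- exact: fl_lift_hom.
- exact: lower_central_model.
exact: fl_lift_pi.
Qed.

Variables (F : comNzRingType) (iota : {rmorphism F -> K}).
Local Notation L := (tensor (free_metab_lie 2 c) F).

Definition model : L -> fil T := tn_lift (fun x a => iota a *f: model_metab x).

Let mDl x y a : iota a *f: model_metab (x + y) = iota a *f: model_metab x + iota a *f: model_metab y.
Proof. by rewrite model_metab_hom.1 raddfD. Qed.

Let mDr x a b : iota (a + b) *f: model_metab x = iota a *f: model_metab x + iota b *f: model_metab x.
Proof. by rewrite rmorphD fil_scaleDl. Qed.

Lemma model_tens x a : model (tens x a) = iota a *f: model_metab x.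
Proof. exact: tn_lift_pure. Qed.

Lemma modelD u v : model (u + v) = model u + model v.
Proof. exact: tn_liftD. Qed.

Lemma model_lbr u v : model (lbr u v) = lbr (model u) (model v).
Proof.
move: u; apply: tensor_ext => [u w|u w|x a].
- by rewrite lbrDl modelD.
- by rewrite modelD lbrDl.
move: v; apply: tensor_ext => [u w|u w|y b].
- by rewrite lbrDr modelD.
- by rewrite modelD lbrDr.
rewrite [lbr _ _](tn_br_pure x a y b) !model_tens model_metab_hom.2.
by rewrite fil_lbrZl fil_lbrZr fil_scaleA rmorphM.
Qed.

End Model.

(** * Normal forms in the free metabelian Lie ring *)

Section Monomials.
Variable c : nat.
Hypothesis c2 : (1 < c)%N.
Local Notation FL := (free_lie 'I_2).
Local Notation N := (free_nilp_lie 2 c).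
Local Notation M := (free_metab_lie 2 c).

Definition metab_pi (x : FL) : M := lq_pi _ (lq_pi _ x).

Lemma metab_pi_hom : lie_hom metab_pi.
Proof.
split=> x y; rewrite /metab_pi; first by rewrite !lq_piD.
by rewrite /lbr /= -lq_piB -lq_piB.
Qed.

Lemma metab_pi_ind (P : M -> Prop) : (forall x, P (metab_pi x)) -> forall y, P y.
Proof. by move=> H; elim/lq_ind; elim/lq_ind. Qed.

Definition metab_gen (i : 'I_2) : M := metab_pi (fl_gen i).
Local Notation x1 := (metab_gen ord0).
Local Notation x2 := (metab_gen ord_max).

(** A monomial of degree i + j + 2: it vanishes as soon as i + j >= c - 1. *)
Definition mono (i j : nat) : M :=
  iter i (lbr x1) (iter j (lbr x2) (lbr x1 x2)).

(** Stated through lifts to [N], because the relations that define [M] are brackets of elements of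
    the derived ideal of [N]. *)
Definition in_derived (y : M) := exists2 x, x \in derived_ideal N & y = lq_pi _ x.

Lemma in_derived_lbr y z : in_derived (lbr y z).
Proof.
elim/lq_ind: y => y; elim/lq_ind: z => z; exists (lbr y z); last by rewrite -lq_piB.
exact/asboolP/CS_br.
Qed.

Lemma lbr_in_derived y z : in_derived y -> in_derived z -> lbr y z = 0.
Proof.
move=> [x xd ->] [x' xd' ->]; rewrite [LHS]lq_piB -(lq_pi0 (second_derived_ideal N)).
apply/lq_piP; rewrite subr0; exact/asboolP/CS_br.
Qed.

Lemma mono_derived i j : in_derived (mono i j).
Proof.
case: i => [|i]; last exact: in_derived_lbr.
by case: j => [|j]; exact: in_derived_lbr.
Qed.

Lemma lbr_x1_mono i j : lbr x1 (mono i j) = mono i.+1 j.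
Proof. by []. Qed.

(** By the Jacobi identity ad x1 and ad x2 commute up to ad [x2, x1], which is zero on the derived
    ring. *)
Lemma lbr_x2_mono i j : lbr x2 (mono i j) = mono i j.+1.
Proof.
elim: i => [//|i IH]; rewrite -[mono i.+1 j]/(lbr x1 (mono i j)) lbr_leibniz IH.
rewrite [X in X + _]lbr_in_derived ?add0r //; first exact: in_derived_lbr.
exact: mono_derived.
Qed.

Lemma lower_central_decr (L : lieRingType) k l (x : L) : (k <= l)%N ->
  x \in lower_central L l.+1 -> x \in lower_central L k.+1.
Proof.
move=> kl; move: x; elim: l kl => [|l IH]; first by rewrite leqn0 => /eqP ->.
rewrite leq_eqVlt => /orP[/eqP -> //|kl] x /asboolP; elim=> {x} [y z yl _||y z _ Hy _ Hz].
- by rewrite lbrC rpredN lie_ideal_closed // IH.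
- exact: rpred0.
- exact: rpredB.
Qed.

Lemma mono_lower_central i j : exists2 x, x \in lower_central FL (i + j).+2 &
  mono i j = metab_pi x.
Proof.
have step k y x : x \in lower_central FL k.+1 -> lbr y x \in lower_central FL k.+2.
  by move=> xk; rewrite lbrC rpredN; apply/asboolP/CS_br.
elim: i => [|i [x xi E]]; last first.
  exists (lbr (fl_gen ord0) x); first exact: step.
  by rewrite -lbr_x1_mono E -metab_pi_hom.2.
elim: j => [|j [x xi E]]; last first.
  exists (lbr (fl_gen ord_max) x); first exact: step.
  by rewrite -lbr_x2_mono E -metab_pi_hom.2.
exists (lbr (fl_gen ord0) (fl_gen ord_max)); first exact: step.
by rewrite metab_pi_hom.2.
Qed.

Lemma mono0 i j : (c.-1 <= i + j)%N -> mono i j = 0.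
Proof.
move=> cij; have [x xij ->] := mono_lower_central i j.
have xc : x \in lower_central FL c.+1.
  by apply: lower_central_decr xij; lia.
by rewrite -(lie_hom0 metab_pi_hom) /metab_pi; congr lq_pi; apply/lq_piP; rewrite subr0.
Qed.

Variable F : finFieldType.
Local Notation L := (tensor M F).

Lemma tens0r (x : M) : tens x (0 : F) = 0.
Proof. by apply: (addIr (tens x 0)); rewrite -tensDr !add0r. Qed.

Lemma tensNl (x : M) (a : F) : tens (- x) a = - tens x a.
Proof. by apply: (addIr (tens x a)); rewrite -tensDl !addNr tens0l. Qed.

Lemma tens_mulrn (x : M) (a : F) n : tens x a *+ n = tens x (a *+ n).
Proof. by elim: n => [|n IH]; rewrite ?mulr0n ?tens0r // !mulrS tensDr IH. Qed.

Lemma tensor_pchar p : p \in [pchar F] -> forall u : L, u *+ p = 0.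
Proof.
move=> pF; apply: (tensor_ext (g' := fun=> 0)) => [u v|u v|x a]; rewrite ?addr0 //.
  by rewrite mulrnDl.
by rewrite tens_mulrn (mulrn_pchar pF) tens0r.
Qed.

Lemma lbr_tens (x y : M) (a b : F) : lbr (tens x a) (tens y b) = tens (lbr x y) (a * b).
Proof. exact: tn_br_pure. Qed.

Local Notation I := ('I_2 + 'I_c * 'I_c)%type.

(** A spanning family: the square index set also contains pairs with i + j >= c - 1, whose monomials
    are zero. *)
Definition basis_elt (k : I) : M :=
  match k with inl i => metab_gen i | inr ij => mono ij.1 ij.2 end.

Definition comb (P : I -> F) : L := \sum_k tens (basis_elt k) (P k).

Definition is_comb (u : L) := exists P, u = comb P.

Lemma is_combD u v : is_comb u -> is_comb v -> is_comb (u + v).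
Proof.
move=> [P ->] [Q ->]; exists (fun k => P k + Q k); rewrite /comb -big_split.
by apply: eq_bigr => k _; rewrite /= tensDr.
Qed.

Lemma is_comb0 : is_comb 0.
Proof. by exists (fun=> 0); rewrite /comb big1 // => k _; rewrite tens0r. Qed.

Lemma is_combN u : is_comb u -> is_comb (- u).
Proof.
move=> [P ->]; exists (fun k => - P k); rewrite /comb -sumrN.
apply: eq_bigr => k _; apply/esym/eqP; rewrite -subr_eq0 opprK -tensDr addNr.
by rewrite tens0r.
Qed.

Lemma is_comb_sum (J : Type) (r : seq J) (Q : pred J) (G : J -> L) :
  (forall j, Q j -> is_comb (G j)) -> is_comb (\sum_(j <- r | Q j) G j).
Proof. by move=> QG; elim/big_ind: _ => //; [exact: is_comb0|exact: is_combD]. Qed.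

Lemma is_comb_basis k a : is_comb (tens (basis_elt k) a).
Proof.
exists (fun k' => if k' == k then a else 0); rewrite /comb (bigD1 k) //= eqxx big1 ?addr0 //.
by move=> k' /negPf ->; rewrite tens0r.
Qed.

Lemma is_comb_mono i j a : is_comb (tens (mono i j) a).
Proof.
case: (leqP c.-1 (i + j)) => [/mono0 ->|ij]; first by rewrite tens0l; exact: is_comb0.
have ic : (i < c)%N by lia.
have jc : (j < c)%N by lia.
exact: (is_comb_basis (inr (Ordinal ic, Ordinal jc))).
Qed.

Lemma is_comb_lbr u v : is_comb u -> is_comb v -> is_comb (lbr u v).
Proof.
have suml (J : Type) (r : seq J) (G : J -> L) w :
    lbr (\sum_(j <- r) G j) w = \sum_(j <- r) lbr (G j) w.
  by elim/big_rec2: _ => [|j a b _ <-]; rewrite ?lbr0l // lbrDl.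
have sumr (J : Type) (r : seq J) (G : J -> L) w :
    lbr w (\sum_(j <- r) G j) = \sum_(j <- r) lbr w (G j).
  by elim/big_rec2: _ => [|j a b _ <-]; rewrite ?lbr0r // lbrDr.
have xm (i : 'I_2) j k a : is_comb (tens (lbr (metab_gen i) (mono j k)) a).
  have [->|->] : i = ord0 \/ i = ord_max.
    by case: i => [[|[|//]] ?]; [left|right]; apply: val_inj.
  - by rewrite lbr_x1_mono; exact: is_comb_mono.
  - by rewrite lbr_x2_mono; exact: is_comb_mono.
move=> [P ->] [Q ->]; rewrite /comb suml; apply: is_comb_sum => k _.
rewrite sumr; apply: is_comb_sum => l _; rewrite lbr_tens.
case: k l => [i|[i j]] [i'|[i' j']] /=.
- have two (k : 'I_2) : k = ord0 \/ k = ord_max.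
    by case: k => [[|[|//]] ?]; [left|right]; apply: val_inj.
  have [->|->] := two i; have [->|->] := two i'; rewrite ?lbrxx ?tens0l; try exact: is_comb0.
    exact: (is_comb_mono 0 0).
  rewrite lbrC tensNl; apply: is_combN; exact: (is_comb_mono 0 0).
- exact: xm.
- by rewrite lbrC tensNl; apply: is_combN; exact: xm.
- by rewrite lbr_in_derived ?tens0l; [exact: is_comb0|exact: mono_derived|exact: mono_derived].
Qed.

(** The combinations form a Lie subring containing all multiples of the generators; the proof is an
    induction on bracket expressions. *)
Lemma tensor_comb (u : L) : is_comb u.
Proof.
elim/tn_ind: u; elim=> [x a||s IHs|s IHs t IHt].
- rewrite -/(tens x a); elim/metab_pi_ind: x a; elim/fl_ind.
  elim=> [i||s IHs|s IHs t IHt|s IHs t IHt] a.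
  + exact: (is_comb_basis (inl i)).
  + by rewrite (lie_hom0 metab_pi_hom) tens0l; exact: is_comb0.
  + by rewrite -fl_piN (lie_homN metab_pi_hom) tensNl; exact: is_combN.
  + by rewrite -fl_piD metab_pi_hom.1 tensDl; exact: is_combD.
  (* The scalar goes to one side only: [x, y] (x) a is the bracket of x (x) a and y (x) 1. *)
  + by rewrite -fl_piB metab_pi_hom.2 -[a]mulr1 -lbr_tens; exact: is_comb_lbr.
- exact: is_comb0.
- by rewrite tn_piN; exact: is_combN.
- by rewrite tn_piD; exact: is_combD.
Qed.

End Monomials.

(** * Evaluation in the truncated polynomial ring *)

Section Truncated.
Variables (c p : nat) (F : finFieldType).
Hypotheses (c2 : (1 < c)%N) (pF : p \in [pchar F]) (cp : (c < p)%N).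
Let p_pr : prime p := pcharf_prime pF.
Let c0 : (0 < c)%N := ltnW c2.
Local Notation M := (free_metab_lie 2 c).
Local Notation L := (tensor M F).
Local Notation x1 := (metab_gen c ord0).
Local Notation x2 := (metab_gen c ord_max).

Definition tpoly : comNzRingType := {poly %/ ('X^c : {poly F})}.

Definition tq : {rmorphism {poly F} -> tpoly} := in_qpoly ('X^c : {poly F}).
Definition tC : {rmorphism F -> tpoly} := tq \o polyC.
Definition tT : tpoly := tq 'X.

Definition tcoef (u : tpoly) (i : nat) : F := (val (u : {poly %/ ('X^c : {poly F})}))`_i.

Lemma tcoef_tq a i : tcoef (tq a) i = if (i < c)%N then a`_i else 0.
Proof.
rewrite /tcoef /= mk_monic_Xn (prednK c0) -Pdiv.RingMonic.take_poly_rmodp.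
exact: coef_take_poly.
Qed.

Lemma tq_val (u : tpoly) : u = tq (val (u : {poly %/ ('X^c : {poly F})})).
Proof.
apply: val_inj; rewrite /= Pdiv.Ring.rmodp_small //.
exact: size_mk_monic.
Qed.

Lemma tcoef_eq (u v : tpoly) : (forall i, (i < c)%N -> tcoef u i = tcoef v i) -> u = v.
Proof.
move=> uv; rewrite (tq_val u) (tq_val v); apply/eqX_qpoly => //.
by apply/eqXP => i ic; exact: uv.
Qed.

Lemma tcoefB (u v : tpoly) i : tcoef (u - v) i = tcoef u i - tcoef v i.
Proof. by rewrite (tq_val u) (tq_val v) -rmorphB !tcoef_tq coefB; case: ifP; rewrite ?subr0. Qed.

Lemma tcoefD (u v : tpoly) i : tcoef (u + v) i = tcoef u i + tcoef v i.
Proof. by rewrite (tq_val u) (tq_val v) -rmorphD !tcoef_tq coefD; case: ifP; rewrite ?addr0. Qed.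

Lemma tT_nilp : tT ^+ c = 0.
Proof.
rewrite /tT -rmorphXn; apply: tcoef_eq => i ic.
by rewrite -(rmorph0 tq) !tcoef_tq ic coefXn coef0 ltn_eqF.
Qed.

Lemma tT_nilp1 : tT ^+ p.-1 = 0.
Proof. by rewrite -(@subnK c p.-1) ?exprD ?tT_nilp ?mulr0 //; lia. Qed.

Lemma pchar_tpoly : p \in [pchar tpoly].
Proof. exact: (rmorph_pchar tC). Qed.

Lemma nilp_cancel (r w : tpoly) : (1 + tT * r) * w = 0 -> w = 0.
Proof.
rewrite mulrDl mul1r => /eqP; rewrite addr_eq0 -mulNr => /eqP E.
have En n : w = (- (tT * r)) ^+ n * w.
  by elim: n => [|n IH]; rewrite ?mul1r // exprSr -mulrA -E.
by rewrite (En c) -mulrN exprMn tT_nilp !mul0r.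
Qed.

(** Since phi_t has constant term 1 and T is nilpotent, phi_t(T) is cancellable: passing from v to
    phi_t v loses nothing. *)
Lemma tT_pphi_cancel t (w w' : tpoly) :
  (pphi p t).[tT] * w = (pphi p t).[tT] * w' -> w = w'.
Proof.
move=> /eqP; rewrite -subr_eq0 -mulrBr => /eqP E.
apply/eqP; rewrite -subr_eq0; apply/eqP; move: E.
have [r ->] : exists r, (pphi p t).[tT] = 1 + tT * r.
  exists (drop_poly 1 (pphi p t)).[tT].
  rewrite -{1}(poly_take_drop 1 (pphi p t)) hornerD hornerM hornerXn expr1 mulrC.
  congr (_ + _); rewrite (_ : take_poly 1 _ = 1) ?hornerC //.
  apply/polyP => i; rewrite coef_take_poly coef1; case: i => [|i] //.
  exact: (pphi0E pchar_tpoly).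
exact: nilp_cancel.
Qed.

Lemma natr_inj_lt (i j : nat) : (i < p)%N -> (j < p)%N -> i%:R = j%:R :> F -> i = j.
Proof.
clear c0 c2 cp; wlog ij : i j / (i <= j)%N.
  move=> W ip jp E; case: (leqP i j) => [/W|/ltnW/W]; first exact.
  by move=> W'; apply/esym/W'.
move=> ip jp /esym/eqP; rewrite -subr_eq0 -natrB // -(dvdn_pcharf pF) => d.
have : (j - i = 0)%N by apply/eqP; move: d; apply: contraLR; rewrite -lt0n => ?; rewrite gtnNdvd //; lia.
lia.
Qed.

(** The Vandermonde argument in terms of roots: 0, ..., n - 1 are distinct in F because n <= p. *)
Lemma poly_natr_eq0 n (r : {poly F}) : (size r <= n <= p)%N ->
  (forall k, (k < n)%N -> r.[k%:R] = 0) -> r = 0.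
Proof.
clear c0 c2 cp; move=> /andP[sr np] r0; apply/eqP; apply: contraTT sr => rn0; rewrite -ltnNge.
have := @max_poly_roots _ r [seq k%:R | k <- iota 0 n] rn0.
rewrite size_map size_iota; apply.
  by apply/allP => x /mapP[k]; rewrite mem_iota add0n => kn ->; apply/eqP/r0.
rewrite map_inj_in_uniq ?iota_uniq // => i j; rewrite !mem_iota !add0n => ic jc.
by apply: natr_inj_lt; exact: leq_trans np.
Qed.

Definition ev (z : F) : L -> fil tT := model tT (tC z) tC.

Lemma ev_hom z : lie_hom (ev z).
Proof. by split=> u v; [exact: (modelD c0 tT_nilp) | exact: (model_lbr c0 tT_nilp)]. Qed.

Lemma model_x1 z : model_metab tT (tC z) x1 = (1, 0).
Proof. exact: (model_metab_pi c0 tT_nilp _ (LGen ord0)). Qed.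

Lemma model_x2 z : model_metab tT (tC z) x2 = (tC z, 1).
Proof. exact: (model_metab_pi c0 tT_nilp _ (LGen ord_max)). Qed.

Lemma model_mono z i j : model_metab tT (tC z) (mono c i j) = (0, tT ^+ (i + j).+1 * tC z ^+ j).
Proof.
have hb := (model_metab_hom c0 tT_nilp (tC z)).2.
elim: i => [|i IH]; last first.
  rewrite -[mono c i.+1 j]/(lbr _ (mono c i j)) hb IH model_x1.
  by apply: fil_eqP; rewrite // fil_lbr2 /= mul1r mul0r subr0 mulrA -exprS.
elim: j => [|j IH]; last first.
  rewrite -[mono c 0 j.+1]/(lbr _ (mono c 0 j)) hb IH model_x2.
  apply: fil_eqP; rewrite // fil_lbr2 /= mul0r subr0 addnS.
  by rewrite [tT ^+ _.+2]exprS [tC z ^+ _.+1]exprS [RHS]mulrACA -[RHS]mulrA.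
rewrite /mono /= hb model_x1 model_x2.
by apply: fil_eqP; rewrite // fil_lbr2 /= mulr0 subr0 expr0 !mulr1.
Qed.

Local Notation I := ('I_2 + 'I_c * 'I_c)%type.

Lemma ev_tens z x a : ev z (tens x a) = fil_scale (tC a) (model_metab tT (tC z) x).
Proof. exact: (model_tens c0 tT_nilp). Qed.

Lemma ev_comb z (P : I -> F) : ev z (comb P) =
  (tC (P (inl ord0) + z * P (inl ord_max)),
   tq ((P (inl ord_max))%:P +
       \sum_(ij : 'I_c * 'I_c) (P (inr ij) * z ^+ ij.2)%:P * 'X^((ij.1 + ij.2).+1))).
Proof.
have evsum (J : Type) (r : seq J) (G : J -> L) :
    ev z (\sum_(j <- r) G j) = \sum_(j <- r) ev z (G j).
  elim/big_rec2: _ => [|j a b _ <-]; first exact: lie_hom0 (ev_hom z).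
  exact: (ev_hom z).1.
rewrite /comb evsum big_sumType /= big_ord_recl big_ord1.
have -> : lift ord0 ord0 = ord_max :> 'I_2 by apply: val_inj.
rewrite !ev_tens model_x1 model_x2.
have -> : \sum_(ij : 'I_c * 'I_c) ev z (tens (mono c ij.1 ij.2) (P (inr ij))) =
   ((0, tq (\sum_(ij : 'I_c * 'I_c) (P (inr ij) * z ^+ ij.2)%:P * 'X^((ij.1 + ij.2).+1))) : fil tT).
  apply: fil_eqP; rewrite ?fil_sum1 ?fil_sum2 /=.
    by rewrite big1 // => ij _; rewrite ev_tens model_mono /= mulr0.
  rewrite [RHS](rmorph_sum tq); apply: eq_bigr => ij _.
  rewrite ev_tens model_mono.
  rewrite -[LHS]/(tq (P (inr ij))%:P * (tq 'X ^+ (ij.1 + ij.2).+1 * tq z%:P ^+ ij.2)).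
  rewrite -!(rmorphXn tq) -!(rmorphM tq); congr (tq _).
  by rewrite polyCM polyC_exp -mulrA; congr (_ * _); rewrite mulrC.
apply: fil_eqP.
  rewrite -[LHS]/(tC (P (inl ord0)) * 1 + tC (P (inl ord_max)) * tC z + 0).
  by rewrite addr0 mulr1 -(rmorphM tC) -(rmorphD tC) mulrC.
rewrite -[LHS]/(tC (P (inl ord0)) * 0 + tq (P (inl ord_max))%:P * 1 + tq _).
by rewrite mulr0 add0r mulr1 -(rmorphD tq).
Qed.

(** The coefficient of T^n at z = k is a polynomial in k whose coefficients are the coordinates (i,
    j) with i + j + 1 = n. Its degree is less than n <= c - 1, so c - 1 values determine it. *)
Lemma ev_inj u v : (forall k, (k < c.-1)%N -> ev k%:R u = ev k%:R v) -> u = v.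
Proof.
move=> uv; apply/eqP; rewrite -subr_eq0; apply/eqP.
have [P EP] := tensor_comb c2 (u - v); have : forall k, (k < c.-1)%N -> ev k%:R (comb P) = 0.
  by move=> k kc; rewrite -EP (lie_homB (ev_hom _)) uv // subrr.
rewrite {}EP => {uv} P0.
have c1 : (0 < c.-1)%N by lia.
have Px2 : P (inl ord_max) = 0.
  have := congr1 (fun x : fil tT => tcoef x.2 0) (P0 0%N c1).
  rewrite ev_comb /= -(rmorph0 tq) !tcoef_tq c0 coefD coefC coef0 /= coef_sum big1 ?addr0 //.
  by move=> ij _; rewrite coefMXn.
have Px1 : P (inl ord0) = 0.
  have := congr1 (fun x : fil tT => tcoef x.1 0) (P0 0%N c1).
  by rewrite ev_comb /= -(rmorph0 tq) !tcoef_tq c0 coefC coef0 /= mul0r addr0.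
have Pij (i j : 'I_c) : (i + j < c.-1)%N -> P (inr (i, j)) = 0.
  move=> ij; set n := (i + j).+1.
  (* For b < n this is the coordinate at (n - 1 - b, b); the sum and [insub] extend it to all
     natural numbers. *)
  pose s (b : nat) := \sum_(a < c | (a + b).+1 == n)
    (if insub b is Some b' then P (inr (a, b')) else 0).
  have : \poly_(b < n) s b = 0.
    apply: (@poly_natr_eq0 c.-1); first by rewrite (leq_trans (size_poly _ _)); lia.
    move=> k kc; have := congr1 (fun x : fil tT => tcoef x.2 n) (P0 k kc).
    rewrite ev_comb /= -(rmorph0 tq) !tcoef_tq.
    have -> : (n < c)%N by lia.
    rewrite coefD coefC coef0 /= add0r => E.
    rewrite -[RHS]E horner_poly coef_sum.
    pose G (a b : 'I_c) := if (a + b).+1 == n then P (inr (a, b)) * k%:R ^+ b else 0.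
    rewrite (eq_bigr (fun ab : 'I_c * 'I_c => G ab.1 ab.2)); last first.
      move=> [a b] _; rewrite coefCM coefXn eq_sym /G /=.
      by case: ifP; rewrite ?mulr1 ?mulr0.
    rewrite -(pair_bigA _ G) exchange_big /=.
    rewrite (big_ord_widen c (fun b => s b * k%:R ^+ b)); last by lia.
    rewrite big_mkcond; apply: eq_bigr => b _.
    rewrite -big_mkcond /= -mulr_suml; case: ifP => bn.
      by congr (_ * _); apply: eq_bigr => a _; rewrite valK.
    by rewrite big_pred0 ?mul0r // => a; apply/negP; lia.
  move=> /(congr1 (fun q : {poly F} => q`_j)); rewrite coef_poly coef0.
  have -> : (j < n)%N by lia.
  rewrite /s (big_pred1 i) ?valK // => a.
  by rewrite eqSS eqn_add2r.
rewrite /comb big_sumType /= big_ord_recl big_ord1.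
have -> : lift ord0 ord0 = ord_max :> 'I_2 by apply: val_inj.
rewrite Px1 Px2 !tens0r !add0r big1 // => -[i j] _ /=.
case: (leqP c.-1 (i + j)) => ij; first by rewrite mono0 // tens0l.
by rewrite Pij // tens0r.
Qed.

Lemma bch_ev z u v : (ev z (bch p u v)).1 = (ev z u).1 + (ev z v).1 /\
  (pphi p ((ev z u).1 + (ev z v).1)).[tT] * (ev z (bch p u v)).2 =
    (pphi p (ev z u).1).[tT] * (ev z u).2 +
    (pexp p (ev z u).1).[tT] * (pphi p (ev z v).1).[tT] * (ev z v).2.
Proof.
pose hA := GRing.isZmodMorphism.Build _ _ (ev z) (lie_homB (ev_hom z)).
pose H : {additive L -> fil tT} := HB.pack (ev z) hA.
have -> : ev z (bch p u v) = bch p (ev z u) (ev z v).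
  apply: (bch_hom p_pr (h := H) (ev_hom z).2); first exact: (tensor_pchar pF).
  exact: fil_pchar pchar_tpoly.
exact: (bch_fil pchar_tpoly _ _ tT_nilp1).
Qed.

Lemma ev1 z u : exists t, (ev z u).1 = tC t.
Proof. by have [P ->] := tensor_comb c2 u; rewrite ev_comb /=; eexists. Qed.

End Truncated.

(** * The upper bound *)

(** The matrices act on row vectors: basis row x goes to w g x times basis row s g x. Hence [s]
    composes from left to right and [w] is a cocycle for it. *)
Lemma monomial_repr (C : fieldType) (G : Type) (mul : G -> G -> G) (X : finType)
    (s : G -> X -> X) (w : G -> X -> C) :
    (forall g, injective (s g)) -> (forall g x, w g x != 0) ->
    (forall g h x, s (mul g h) x = s h (s g x)) ->
    (forall g h x, w (mul g h) x = w g x * w h (s g x)) ->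
    (forall g h, (forall x, s g x = s h x /\ w g x = w h x) -> g = h) ->
  exists rho : G -> 'M[C]_#|X|, faithful_repr mul rho.
Proof.
move=> s_inj w0 sM wM sw_inj.
pose rho g : 'M[C]_#|X| := \matrix_(i, j)
  if s g (enum_val i) == enum_val j then w g (enum_val i) else 0.
exists rho; split=> [g|g h|g h E].
(* The transposed pattern with inverted weights, an inverse because [s g] is injective. *)
- pose N : 'M[C]_#|X| := \matrix_(j, i)
    if s g (enum_val i) == enum_val j then (w g (enum_val i))^-1 else 0.
  have /mulmx1_unit[] // : rho g *m N = 1%:M.
  apply/matrixP => i j; rewrite !mxE (bigD1 (enum_rank (s g (enum_val i)))) //= big1 => [|k kE].
    rewrite !mxE enum_rankK eqxx addr0 [s g (enum_val j) == _]eq_sym (inj_eq (s_inj g)).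
    rewrite (inj_eq enum_val_inj); case: eqVneq => [->|_]; last by rewrite mulr0.
    by rewrite mulfV.
  rewrite !mxE ifN ?mul0r //; apply: contra kE => /eqP ->.
  by rewrite enum_valK.
- apply/matrixP => i j; rewrite !mxE (bigD1 (enum_rank (s g (enum_val i)))) //= big1 => [|k kE].
    rewrite !mxE enum_rankK eqxx addr0 sM wM.
    by case: ifP; rewrite ?mulr0.
  rewrite !mxE ifN ?mul0r //; apply: contra kE => /eqP ->.
  by rewrite enum_valK.
- apply: sw_inj => x; move/matrixP/(_ (enum_rank x) (enum_rank (s g x))): E.
  rewrite !mxE !enum_rankK eqxx; case: eqP => [-> //|_ E].
  by have := w0 g x; rewrite E eqxx.
Qed.

Lemma exists_prim_root (C : numClosedFieldType) n : (0 < n)%N ->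
  exists w : C, n.-primitive_root w.
Proof.
move=> n0; have [rs Ers] := closed_field_poly_normal ('X^n - 1 : {poly C}).
rewrite (monicP (monicXnsubC 1 n0)) scale1r in Ers.
have srs : size rs = n.
  by apply: succn_inj; rewrite -(size_prod_XsubC rs id) -Ers size_XnsubC.
have : has n.-primitive_root rs.
  apply: cyclic.has_prim_root => //; last by rewrite srs.
    by apply/allP => z; rewrite /root_of_unity Ers root_prod_XsubC.
  by rewrite -separable_prod_XsubC -Ers separable_Xn_sub_1 // Num.Theory.pnatr_eq0 -lt0n.
by case/hasP => w _ w_prim; exists w.
Qed.

(** * Additive characters of F *)

Section FpCharacter.
Variables (C : fieldType) (p : nat) (w : C).
Hypotheses (p_pr : prime p) (w_prim : p.-primitive_root w).

Definition Fp_char (a : 'F_p) : C := w ^+ a.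

Lemma Fp_charD a b : Fp_char (a + b) = Fp_char a * Fp_char b.
Proof.
rewrite /Fp_char -exprD /=; apply/eqP; rewrite (eq_prim_root_expr w_prim).
move: (a + b)%N => n; by rewrite Fp_cast // modn_mod.
Qed.

Lemma Fp_char_neq0 a : Fp_char a != 0.
Proof. rewrite /Fp_char expf_neq0 //; apply/eqP => w0; have /eqP := prim_expr_order w_prim.
by rewrite w0 expr0n gtn_eqF ?prime_gt0 // eq_sym oner_eq0. Qed.

Lemma Fp_char_inj : injective Fp_char.
Proof.
move=> a b /eqP; rewrite (eq_prim_root_expr w_prim) => /eqP E; apply: val_inj.
have lt (x : 'F_p) : (x < p)%N by have := ltn_ord x; rewrite [X in (_ < X)%N](Fp_cast p_pr).
by move: E; rewrite !modn_small.
Qed.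

End FpCharacter.

(** Composing the coordinates with [Fp_char] yields f additive characters of F that are jointly
    injective. *)
Lemma Fp_coordinates p f (F : finFieldType) : prime p -> p \in [pchar F] -> #|F| = (p ^ f)%N ->
  exists phi : F -> 'rV['F_p]_f, injective phi /\ (forall a b, phi (a + b) = phi a + phi b).
Proof.
move=> p_pr pF cF; have [phi lin bij] := pprimeChar_vectAxiom pF.
have -> : f = logn p #|pPrimeCharType pF| by rewrite [#|_|]cF pfactorK.
by exists phi; split; [exact: bij_inj|move=> a b; have := lin 1 a b; rewrite !scale1r].
Qed.

Section Upper.
Variables (c p f : nat) (F : finFieldType).
Hypotheses (c2 : (1 < c)%N) (pF : p \in [pchar F]) (cp : (c < p)%N) (cF : #|F| = (p ^ f)%N).
Let p_pr : prime p := pcharf_prime pF.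
Let c0 : (0 < c)%N := ltnW c2.
Local Notation L := (tensor (free_metab_lie 2 c) F).
Local Notation tT := (tT c F).
Local Notation K := (tpoly c F).
Let pK : p \in [pchar K] := pchar_tpoly c pF.

(** In the coordinates [ev_t], [ev_n] the group law is that of a semidirect product. The phase
    [ev_lam z y u] is the top coefficient of e_y n, a cocycle for the translation of y by
    [ev_t z u]. *)
Definition ev_t (z : F) (u : L) : F := tcoef (ev z u).1 0.
Definition ev_n (z : F) (u : L) : K := (pphi p (ev z u).1).[tT] * (ev z u).2.
Definition texp (y : F) : K := (pexp p (tC c F y)).[tT].
Definition ev_lam (z y : F) (u : L) : F := tcoef (texp y * ev_n z u) c.-1.

Lemma ev_tE z u : (ev z u).1 = tC c F (ev_t z u).
Proof. by rewrite /ev_t; have [t ->] := ev1 c2 z u; rewrite /tC /= tcoef_tq // c0 coefC. Qed.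

Lemma texpE y : texp y = tq c F (pexp p y).
Proof.
rewrite /texp /pexp horner_poly poly_def (rmorph_sum (tq c F)); apply: eq_bigr => r _.
rewrite -mul_polyC (rmorphM (tq c F)) (rmorphXn (tq c F)); congr (_ * _).
by rewrite -[RHS]/(tC c F _) rmorphM rmorphXn /natV rmorph_nat.
Qed.

Lemma texpD y y' : texp y * texp y' = texp (y + y').
Proof.
rewrite !texpE -(rmorphM (tq c F)); apply/eqX_qpoly => //.
by apply: eqX_sub (pexpD pF y y'); exact: ltnW.
Qed.

Lemma ev_t_bch z u v : ev_t z (bch p u v) = ev_t z u + ev_t z v.
Proof. by rewrite /ev_t (bch_ev c2 pF cp z u v).1 tcoefD. Qed.

Lemma ev_n_bch z u v : ev_n z (bch p u v) = ev_n z u + texp (ev_t z u) * ev_n z v.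
Proof.
have [E1 E2] := bch_ev c2 pF cp z u v.
by rewrite /ev_n E1 E2 /texp -ev_tE mulrA.
Qed.

Lemma ev_lam_bch z y u v :
  ev_lam z y (bch p u v) = ev_lam z y u + ev_lam z (y + ev_t z u) v.
Proof. by rewrite /ev_lam ev_n_bch mulrDr mulrA texpD tcoefD. Qed.

(** The top coefficient of e_y n is a polynomial in y of degree less than c, with coefficients
    n_(c-1-i) / i!; knowing it at c points determines n. *)
Lemma ev_lam_inj z u v : (forall y, ev_lam z y u = ev_lam z y v) -> ev_n z u = ev_n z v.
Proof.
move=> uv; apply/eqP; rewrite -subr_eq0; apply/eqP; set n := _ - _.
have n0 y : tcoef (texp y * n) c.-1 = 0.
  by rewrite mulrBr tcoefB // -![tcoef _ _]/(ev_lam z y _) uv subrr.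
pose r := \poly_(i < c) (natV F p i`! * tcoef n (c.-1 - i)).
have r0 : r = 0.
  apply: (poly_natr_eq0 pF (n := c)); first by rewrite size_poly ltnW.
  move=> k _; rewrite -[RHS](n0 k%:R) texpE (tq_val n) -(rmorphM (tq c F)).
  rewrite tcoef_tq // prednK // leqnn coefM prednK // horner_poly.
  apply: eq_bigr => i _; rewrite coef_poly (ltn_trans (ltn_ord i) cp).
  by rewrite mulrC mulrA.
apply: (tcoef_eq c2) => i ic.
have := congr1 (fun q : {poly F} => q`_(c.-1 - i)) r0; rewrite coef_poly coef0 ifT; last by lia.
rewrite (_ : c.-1 - (c.-1 - i) = i)%N; last by lia.
move=> /(congr1 (fun a => (c.-1 - i)`!%:R * a)).
rewrite mulr0 mulrA (natr_natV pF) ?mul1r; last by rewrite coprime_fact //; lia.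
by move=> ->; rewrite -(rmorph0 (tq c F)) tcoef_tq // ic coef0.
Qed.

(** The basis consists of triples: a value of z, a character, a point y of F. Translations recover
    t; the phases of all characters at all points recover n. *)
Lemma upper_bound (C : numClosedFieldType) :
  exists rho : L -> 'M[C]_((c - 1) * f * p ^ f)%N, faithful_repr (@bch L p) rho.
Proof.
have [w w_prim] := exists_prim_root C (prime_gt0 p_pr).
have [phi [phi_inj phiD]] := Fp_coordinates p_pr pF cF.
have cX : #|{: 'I_(c - 1) * 'I_f * F}| = ((c - 1) * f * p ^ f)%N.
  by rewrite !card_prod !card_ord cF.
rewrite -cX.
pose s (g : L) (x : 'I_(c - 1) * 'I_f * F) := (x.1, x.2 + ev_t x.1.1%:R g).
pose wt (g : L) (x : 'I_(c - 1) * 'I_f * F) :=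
  Fp_char w (phi (ev_lam x.1.1%:R x.2 g) 0 x.1.2).
apply: (monomial_repr (s := s) (w := wt)).
- by move=> g [ki y] [ki' y'] [<- /addIr ->].
- by move=> g x; exact: Fp_char_neq0 w_prim _.
- by move=> g h [[k i] y]; rewrite /s /= ev_t_bch addrA.
- move=> g h [[k i] y]; rewrite /wt /s /= ev_lam_bch phiD mxE.
  exact: Fp_charD.
move=> g h gh; apply: (ev_inj c2 pF cp) => k kc.
have k1 : (k < c - 1)%N by rewrite subn1.
(* Some character index must exist for the translation to be visible; F has more than one
   element. *)
have f0 : (0 < f)%N.
  case: (f) cF => // /eqP; rewrite expn0 => /eqP cF1.
  by have := card_finNzRing_gt1 F; rewrite cF1.
have Et : ev_t k%:R g = ev_t k%:R h.
  by have [[/addrI]] := gh (Ordinal k1, Ordinal f0, 0).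
have E1 : (ev k%:R g).1 = (ev k%:R h).1 by rewrite !ev_tE Et.
apply: fil_eqP => //; apply: (tT_pphi_cancel c2 pF (t := (ev k%:R g).1)).
rewrite [in RHS]E1; apply: ev_lam_inj => y; apply: phi_inj.
apply/rowP => i; have [_] := gh (Ordinal k1, i, y).
exact: Fp_char_inj.
Qed.

End Upper.

(** * The lower bound *)

Section CharacterCount.
Variables (C : numClosedFieldType) (p m : nat) (U Z : finZmodType) (S : finType).
Variables (R : U -> 'M[C]_m) (iz : Z -> U).
Hypothesis p_pr : prime p.
Hypothesis RD : forall u v, R (u + v) = R u *m R v.
Hypothesis R0 : R 0 = 1%:M.
Hypothesis pU : forall u : U, u *+ p = 0.
Hypothesis izD : {morph iz : z z' / z + z'}.
Hypothesis iz_faithful : forall z, R (iz z) = 1%:M -> z = 0.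

(** The rows of [P] form a basis of common left eigenvectors, row i having the character [D i]. *)
Definition row_character (P : 'M[C]_m) (D : 'I_m -> U -> C) :=
  P \in unitmx /\ forall u, P *m R u = diag_mx (\row_i D i u) *m P.

Lemma exists_row_characters : exists P D, row_character P D.
Proof.
have Xp : exists2 rs : seq C, uniq rs & 'X^p - 1 = \prod_(x <- rs) ('X - x%:P).
  have [rs Ers] := closed_field_poly_normal ('X^p - 1 : {poly C}).
  rewrite (monicP (monicXnsubC 1 (prime_gt0 p_pr))) scale1r in Ers; exists rs => //.
  rewrite -separable_prod_XsubC -Ers separable_Xn_sub_1 // Num.Theory.pnatr_eq0.
  by rewrite -lt0n prime_gt0.
have : codiagonalizable [seq R u | u <- enum U].
  apply/codiagonalizableP; split.
    move=> A B /mapP[u _ ->] /mapP[v _ ->].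
    by rewrite /comm_mx -!RD addrC.
  move=> A /mapP[u _ ->].
  have Ru n : R (u *+ n) = iter n (mulmx (R u)) 1%:M.
    by elim: n => [|n IH]; rewrite ?mulr0n ?R0 // mulrS RD IH.
  case: (m) R Ru => [|m'] R' Ru.
    exists 1%:M; first exact: unitmx1.
    by apply/(diagonalizable_forP _ (unitmx1 _ _)) => -[].
  apply/diagonalizableP; case: Xp => rs urs Ers; exists rs => //.
  rewrite -Ers; apply: mxminpoly_min.
  rewrite rmorphB rmorphXn /= horner_mx_X rmorph1.
  have -> n : R' u ^+ n = R' (u *+ n).
    by rewrite Ru; elim: n => [//|n IH]; rewrite exprS IH.
  by rewrite pU (Ru 0%N) subrr.
case=> P Pu /allP dP; exists P, (fun i u => (P *m R u *m invmx P) i i); split=> // u.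
have := dP (R u) (map_f R (mem_enum _ u)) => /(diagonalizable_forP _ Pu) dPu.
rewrite -[LHS](mulmxKV Pu); move: (P *m R u *m invmx P) dPu => A dPu; congr (_ *m P).
apply/matrixP => i j; rewrite !mxE.
by case: eqVneq => [->|/dPu ->]; rewrite ?mulr1n ?mulr0n.
Qed.

(* The character [u |-> chi (d t u)] is the quotient of the conjugate of a
   character above [chi] by that character. *)
Hypothesis twist : forall chi : Z -> C, (forall z z', chi (z + z') = chi z * chi z') ->
  (forall z, chi z != 0) ->
  (exists z, chi z != 1) ->
  exists (g : S -> 'M[C]_m) (d : S -> U -> Z),
   [/\ forall t, g t \in unitmx,
       forall t u, g t *m R u = R (u + iz (d t u)) *m g t,
       forall t z, d t (iz z) = 0
     & forall t t', t != t' -> exists u, chi (d t u) != chi (d t' u)].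

(** N counts the nontrivial characters of Z that occur. They separate points, so Z embeds in the
    functions from them to p-th roots of unity; by [twist], each lies below at least |S| distinct
    characters of U, hence below that many rows. *)
Lemma character_count : exists N, (#|Z| <= p ^ N)%N /\ (N * #|S| <= m)%N.
Proof.
have [P [D [Pu PD]]] := exists_row_characters.
have [w w_prim] := exists_prim_root C (prime_gt0 p_pr).
have iz0 : iz 0 = 0 by apply: (addIr (iz 0)); rewrite -izD !add0r.
have rowD i u : row i P *m R u = D i u *: row i P.
  by rewrite -row_mul PD row_mul row_diag_mx -scalemxAl -rowE mxE.
have row0 i : row i P != 0.
  apply/eqP => r0; have := row_mul i P (invmx P).
  rewrite mulmxV // r0 mul0mx => /rowP/(_ i); rewrite !mxE eqxx => /eqP.
  by rewrite oner_eq0.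
have char_uniq (v : 'rV[C]_m) (a b : C) : v != 0 -> a *: v = b *: v -> a = b.
  move=> v0 /eqP; rewrite -subr_eq0 -scalerBl scaler_eq0 (negPf v0) orbF subr_eq0.
  by move/eqP.
have DD i u v : D i (u + v) = D i u * D i v.
  by apply: char_uniq (row0 i) _; rewrite -rowD RD mulmxA rowD -scalemxAl rowD scalerA mulrC.
have D0 i : D i 0 = 1.
  by apply: char_uniq (row0 i) _; rewrite -rowD R0 mulmx1 scale1r.
have Dp i u : D i u ^+ p = 1.
  rewrite -(D0 i) -(pU u); elim: (p) => [|n IH]; first by rewrite mulr0n D0.
  by rewrite exprS mulrS DD IH.
have D_neq0 i u : D i u != 0.
  have /eqP := Dp i u; apply: contraTneq => ->.
  by rewrite expr0n gtn_eqF ?prime_gt0 // eq_sym oner_eq0.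
(* A common eigenvector has a nonzero coordinate on some row of [P], and that row has the same
   character. *)
have transfer (v : 'rV[C]_m) (e : U -> C) : v != 0 ->
    (forall u, v *m R u = e u *: v) -> exists j, forall u, D j u = e u.
  move=> v0 ve; pose v' := v *m invmx P.
  have vE : v = v' *m P by rewrite /v' mulmxKV.
  clearbody v'.
  have /rV0Pn[j vj] : v' != 0 by apply: contraNneq v0; rewrite vE => ->; rewrite mul0mx.
  exists j => u; have := ve u; rewrite vE -mulmxA PD mulmxA scalemxAl.
  move=> /(congr1 (mulmxr (invmx P))); rewrite /= !mulmxK // => /rowP/(_ j).
  rewrite mul_mx_diag !mxE mulrC; exact: mulIf.
(* The restriction to Z of the i-th character, encoded by exponents of [w] so as to live in a finite
   type. *)
pose kap i : {ffun Z -> 'I_p} := [ffun z => sval (prim_rootP w_prim (Dp i (iz z)))].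
have kapE i z : D i (iz z) = w ^+ kap i z.
  by rewrite ffunE; case: prim_rootP.
clearbody kap.
have w_inj (a b : 'I_p) : w ^+ a = w ^+ b -> a = b.
  move/eqP; rewrite (eq_prim_root_expr w_prim) !modn_small // => /eqP.
  exact: val_inj.
pose o0 : 'I_p := Ordinal (prime_gt0 p_pr).
pose X := [set k in kap @: 'I_m | k != [ffun=> o0]].
exists #|X|; split.
- pose E z : {ffun {k | k \in X} -> 'I_p} := [ffun k => (val k : {ffun Z -> 'I_p}) z].
  have E_inj : injective E.
    move=> z z' EE; apply/eqP; rewrite -subr_eq0; apply/eqP/iz_faithful.
    have Dzz i : D i (iz z) = D i (iz z').
      rewrite !kapE; case: (boolP (kap i \in X)) => [kX|].
        have := congr1 (fun e : {ffun {k | k \in X} -> 'I_p} =>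
            e (exist (fun k => k \in X) _ kX)) EE.
        by rewrite !ffunE /= => ->.
      by rewrite inE imset_f //= negbK => /eqP ->; rewrite !ffunE.
    have D1 i : D i (iz (z - z')) = 1.
      have := DD i (iz z') (iz (z - z')); rewrite -izD addrC subrK Dzz => /esym.
      rewrite -[RHS]mulr1; apply: mulfI; exact: D_neq0.
    rewrite -[R _]mul1mx -(mulVmx Pu) -mulmxA PD.
    rewrite (_ : \row_i D i _ = const_mx 1) ?diag_const_mx ?mul1mx //.
    by apply/rowP => i; rewrite !mxE D1.
  have := leq_card E E_inj; rewrite card_ffun card_ord card_sig.
  by rewrite (eq_card (B := X)).
have fiber k : k \in X -> (#|S| <= #|[set i | kap i == k]|)%N.
  rewrite inE => /andP[/imsetP[i0 _ ->] k0].
  have [|||g [d [gu gR d0 dinj]]] := twist (chi := fun z => D i0 (iz z)).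
  - by move=> z z'; rewrite izD DD.
  - by move=> z; exact: D_neq0.
  - apply/existsP; apply: contraNT k0; rewrite negb_exists => /forallP kz.
    apply/eqP/ffunP => z; rewrite [RHS]ffunE; apply: w_inj; rewrite -kapE expr0.
    by have := kz z; rewrite negbK => /eqP.
  (* Row i0 times g t is again a common eigenvector; its character is the conjugate one, and so
     occurs among the [D j]. *)
  have /choice[j jE] : forall t, exists j, forall u, D j u = D i0 u * D i0 (iz (d t u)).
    move=> t; apply: (transfer (row i0 P *m g t)).
      apply/eqP => /(congr1 (mulmxr (invmx (g t)))); rewrite /= mulmxK // mul0mx.
      by apply/eqP.
    by move=> u; rewrite -mulmxA gR mulmxA rowD DD -scalemxAl.
  have j_inj : injective j.
    move=> t t' jt; apply/eqP; apply: contraT => /dinj[u].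
    have := jE t u; rewrite jt jE => /mulfI ->; by rewrite ?eqxx ?D_neq0.
  suff jS : j @: [set: S] \subset [set i | kap i == kap i0].
    by have := subset_leq_card jS; rewrite (card_imset _ j_inj) cardsT.
  apply/fintype.subsetP => _ /imsetP[t _ ->]; rewrite inE; apply/eqP/ffunP => z.
  by apply: w_inj; rewrite -!kapE jE d0 iz0 D0 mulr1.
have cm := card_ord m; rewrite -sum1_card (partition_big kap xpredT) //= in cm.
apply: leq_trans (eq_leq cm).
rewrite (bigID [in X]) /= (leq_trans _ (leq_addr _ _)) // -sum_nat_const.
by apply: leq_sum => k kX; rewrite sum1dep_card fiber.
Qed.

End CharacterCount.

(** * Products and conjugation in degrees where the series collapses *)

Section Lower.
Variables (c p : nat) (F : finFieldType).
Hypotheses (c2 : (1 < c)%N) (pF : p \in [pchar F]) (cp : (c < p)%N).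
Let p_pr : prime p := pcharf_prime pF.
Local Notation M := (free_metab_lie 2 c).
Local Notation L := (tensor M F).
Local Notation tT := (tT c F).
Local Notation K := (tpoly c F).
Let pK : p \in [pchar K] := pchar_tpoly c pF.

(** The remainder keeps the factor t T, which is what [orth] annihilates. *)
Lemma pphi_expand (t : K) : exists r, (pphi p t).[tT] = 1 + t * tT * r.
Proof.
pose q : {poly K} := \poly_(i < p.-2) (t ^+ i * natV K p i.+2`!).
have E : pphi p t = 1 + t%:P * 'X * q.
  apply/polyP => -[|i]; rewrite coefD coef1 -mulrA coefCM coefXM !coef_poly /=.
    by rewrite (p1_gt0 pK) (natV1 pK) mulr0 addr0 mulr1.
  rewrite add0r; have -> : (i.+1 < p.-1)%N = (i < p.-2)%N by lia.
  by case: ifP; rewrite ?mulr0 // exprS mulrA.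
by exists q.[tT]; rewrite E hornerD !hornerM hornerX !hornerC.
Qed.

Lemma pexp_expand (t : K) : exists r,
  (pexp p t).[tT] = 1 + t * tT + t * tT ^+ 2 * r.
Proof.
have [r E] := pphi_expand t; exists (t * r).
rewrite (pexpE pK) hornerD !hornerM hornerX !hornerC E; ring.
Qed.

(* On elements which are [small] and [orth] to each other, the truncated
   exponentials only enter through their terms of degree at most one. *)
Definition small (u : L) := forall z, tT ^+ 2 * (ev z u).2 = 0 /\ (ev z u).1 * tT ^+ 2 = 0.
Definition orth (u v : L) := forall z, (ev z u).1 * tT * (ev z v).2 = 0.

Lemma ev_eq (u v : L) : (forall z, (ev z u).1 = (ev z v).1) ->
    (forall z, (pphi p (ev z u).1).[tT] * (ev z u).2 = (pphi p (ev z u).1).[tT] * (ev z v).2) ->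
  u = v.
Proof.
move=> uv1 uv2; apply: (ev_inj c2 pF cp) => k _; apply: fil_eqP => //.
exact: (tT_pphi_cancel c2 pF).
Qed.

Lemma bch_orth u v : orth u u -> orth u v -> orth v u -> orth v v -> bch p u v = u + v.
Proof.
move=> uu uv vu vv; apply: ev_eq => z; have [E1 E2] := bch_ev c2 pF cp z u v.
  by rewrite E1 (ev_hom c2 z).1.
rewrite E1 E2 (ev_hom c2 z).1; move: (uu z) (uv z) (vu z) (vv z).
case: (ev z u) (ev z v) => [t a] [s b] /= uuz uvz vuz vvz.
have [r1 ->] := pphi_expand t; have [r2 ->] := pphi_expand s.
have [r3 ->] := pphi_expand (t + s); have [r4 ->] := pexp_expand t.
transitivity (a + b + r1 * (t * tT * a) + (1 + tT * r4) * (1 + s * tT * r2) * (t * tT * b)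
   + r2 * (s * tT * b)).
  by ring.
rewrite uuz uvz vvz.
transitivity (a + b + r3 * (t * tT * a + t * tT * b + s * tT * a + s * tT * b)); last by ring.
by rewrite uuz uvz vuz vvz; ring.
Qed.

(** This is g u g^-1 = exp (ad g) u without inverses; the series stops at u + [g, u] because [g,
    [g, u]] carries T^2, which kills [small] elements. *)
Lemma bch_conj (g u : L) : small u -> orth u u -> bch p g u = bch p (u + lbr g u) g.
Proof.
move=> su uu; apply: ev_eq => z; have [E1 E2] := bch_ev c2 pF cp z g u;
  have [E3 E4] := bch_ev c2 pF cp z (u + lbr g u) g.
  by rewrite E1 E3 (ev_hom c2 z).1 (ev_hom c2 z).2 /= addr0 addrC.
have E13 : (ev z (bch p g u)).1 = (ev z (bch p (u + lbr g u) g)).1.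
  by rewrite E1 E3 (ev_hom c2 z).1 (ev_hom c2 z).2 /= addr0 addrC.
rewrite E13 {2}E3 E4 -E13 E1 E2 (ev_hom c2 z).1 (ev_hom c2 z).2.
have [su2 su1] := su z; have uuz := uu z; rewrite /= addr0.
move: su2 su1 uuz; case: (ev z u) (ev z g) => [t a] [s b] /= su2 su1 uuz.
have [r1 ->] := pphi_expand t; have [r2 ->] := pphi_expand s.
have [r3 ->] := pexp_expand t; have [r4 ->] := pexp_expand s.
transitivity ((1 + s * tT * r2) * b + a + s * tT * a + s * r4 * (tT ^+ 2 * a) +
   (1 + s * tT + s * tT ^+ 2 * r4) * r1 * (t * tT * a)); first by ring.
rewrite su2 uuz.
transitivity ((1 + s * tT * r2) * b + a + s * tT * a + r1 * (t * tT * a) +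
  (t * tT ^+ 2) * (r1 * (s * a - t * b) + s * r2 * b + r3 * (1 + s * tT * r2) * b)); last by ring.
by rewrite uuz su1; ring.
Qed.

End Lower.

(** * The abelian subgroup and its conjugates *)

Section LowerCases.
Variables (c p f : nat) (F : finFieldType).
Hypotheses (c2 : (1 < c)%N) (pF : p \in [pchar F]) (cp : (c < p)%N) (cF : #|F| = (p ^ f)%N).
Let p_pr : prime p := pcharf_prime pF.
Local Notation M := (free_metab_lie 2 c).
Local Notation L := (tensor M F).
Local Notation tT := (tT c F).
Local Notation K := (tpoly c F).
Let pK : p \in [pchar K] := pchar_tpoly c pF.

Local Notation mm z := (model_metab tT (tC c F z)).

Definition alpha n (b : 'I_n -> M) (u : 'rV[F]_n) : L := \sum_i tens (b i) (u 0 i).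

Lemma alphaD n (b : 'I_n -> M) u v : alpha b (u + v) = alpha b u + alpha b v.
Proof. by rewrite /alpha -big_split; apply: eq_bigr => i _; rewrite mxE tensDr. Qed.

Lemma alpha0 n (b : 'I_n -> M) : alpha b 0 = 0.
Proof. by rewrite /alpha big1 // => i _; rewrite mxE tens0r. Qed.

Lemma ev_alpha z n (b : 'I_n -> M) u :
  ev z (alpha b u) = \sum_i fil_scale (tC c F (u 0 i)) (mm z (b i)).
Proof.
rewrite /alpha; transitivity (\sum_i ev z (tens (b i) (u 0 i))).
  elim/big_rec2: _ => [|i a d _ <-]; first exact: lie_hom0 (ev_hom c2 z).
  exact: (ev_hom c2 z).1.
by apply: eq_bigr => i _; rewrite ev_tens.
Qed.

Lemma alpha_small n (b : 'I_n -> M) u :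
    (forall i z, tT ^+ 2 * (mm z (b i)).2 = 0 /\ (mm z (b i)).1 * tT ^+ 2 = 0) ->
  small (alpha b u).
Proof.
move=> H z; rewrite ev_alpha fil_sum1 fil_sum2 mulr_sumr mulr_suml.
split; apply: big1 => i _ /=; have [H2 H1] := H i z.
  by rewrite mulrCA H2 mulr0.
by rewrite -mulrA H1 mulr0.
Qed.

Lemma alpha_orth n (b : 'I_n -> M) u v :
    (forall i j z, (mm z (b i)).1 * tT * (mm z (b j)).2 = 0) ->
  orth (alpha b u) (alpha b v).
Proof.
move=> H z; rewrite !ev_alpha fil_sum1 fil_sum2 mulr_suml mulr_suml.
apply: big1 => i _; rewrite mulr_sumr; apply: big1 => j _ /=.
transitivity (tC c F (u 0 i) * tC c F (v 0 j) * ((mm z (b i)).1 * tT * (mm z (b j)).2)).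
  by ring.
by rewrite H mulr0.
Qed.

Definition top (k : 'I_c.-1) : M := mono c (c.-2 - k) k.

Lemma mm_top z k : mm z (top k) = (0, tT ^+ c.-1 * tC c F z ^+ k).
Proof.
rewrite model_mono //; congr (0, tT ^+ _ * _).
by have := ltn_ord k; lia.
Qed.

Lemma lbr_top e k : lbr (metab_gen c e) (top k) = 0.
Proof.
have [->|->] : e = ord0 \/ e = ord_max.
- by case: e => [[|[|//]] ?]; [left|right]; apply: val_inj.
- by rewrite /top lbr_x1_mono mono0 //; have := ltn_ord k; lia.
- by rewrite /top lbr_x2_mono mono0 //; have := ltn_ord k; lia.
Qed.

(** At the point x the coefficient of T^(c-1) is the value at x of the polynomial with coefficients
    z_k, whose degree is less than c - 1; it vanishes at c - 1 points. *)
Lemma alpha_top_inj z : alpha top z = 0 -> z = 0.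
Proof.
move=> z0; apply/rowP => k; rewrite [RHS]mxE -coef_rVpoly_ord.
suff -> : rVpoly z = 0 by rewrite coef0.
apply: (poly_natr_eq0 pF (n := c.-1)) => [|x _].
  by rewrite size_poly /=; lia.
have := congr1 (fun u : fil tT => tcoef u.2 c.-1) (congr1 (ev x%:R) z0).
rewrite (lie_hom0 (ev_hom c2 x%:R)) ev_alpha fil_sum2 -[RHS]/(tcoef 0 _).
have step (i : 'I_c.-1) : (fil_scale (tC c F (z 0 i)) (mm x%:R (top i))).2 =
    tq c F ((z 0 i)%:P * ('X^(c.-1) * (x%:R)%:P ^+ i)).
  by rewrite mm_top (rmorphM (tq c F)) (rmorphM (tq c F)) (rmorphXn (tq c F)) (rmorphXn (tq c F)).
rewrite (eq_bigr _ (fun i _ => step i)).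
rewrite -(rmorph_sum (tq c F)) -(rmorph0 (tq c F)) !tcoef_tq // prednK ?leqnn; last by lia.
rewrite coef0 coef_sum => E; rewrite -[RHS]E.
rewrite (horner_coef_wide _ (size_poly _ _)); apply: eq_bigr => i _.
by rewrite coef_rVpoly_ord coefCM mulrC -polyC_exp mulrC ['X^_ * _]mulrC coefCM coefXn eqxx mulr1.
Qed.

Section LowerCore.
(* The [b i] complete the basis [top] of the centre to a basis of the abelian
   subgroup; [A e] is the matrix of [ad x_e] from their span to the centre. *)
Variables (n : nat) (b : 'I_n -> M) (A : 'I_2 -> 'M[F]_(n, c.-1)).
Hypothesis b_small : forall i z, tT ^+ 2 * (mm z (b i)).2 = 0 /\ (mm z (b i)).1 * tT ^+ 2 = 0.
Hypothesis b_orth : forall i j z, (mm z (b i)).1 * tT * (mm z (b j)).2 = 0.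
Hypothesis b_lbr : forall e i s, tens (lbr (metab_gen c e) (b i)) s =
  \sum_k tens (top k) (s * A e i k).
Hypothesis A_cover : forall k, exists e (w : 'rV[F]_n), w *m A e = delta_mx 0 k.

Definition full_basis (i : 'I_(c.-1 + n)) : M :=
  match split i with inl k => top k | inr j => b j end.

Lemma alpha_full z w : alpha full_basis (row_mx z w) = alpha top z + alpha b w.
Proof.
rewrite /alpha big_split_ord; congr (_ + _); apply: eq_bigr => i _.
  by rewrite row_mxEl /full_basis -[lshift n i]/(unsplit (inl i)) unsplitK.
by rewrite row_mxEr /full_basis -[rshift _ i]/(unsplit (inr i)) unsplitK.
Qed.

Lemma lbr_alpha e t u : lbr (tens (metab_gen c e) t) (alpha full_basis u) =
  alpha top (t *: (rsubmx u *m A e)).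
Proof.
rewrite -{1}(hsubmxK u) alpha_full lbrDr.
have sumr m (d : 'I_m -> L) x : lbr x (\sum_j d j) = \sum_j lbr x (d j).
  by elim/big_rec2: _ => [|j y y' _ <-]; rewrite ?lbr0r // lbrDr.
rewrite /alpha !sumr big1 ?add0r => [|k _]; last by rewrite lbr_tens lbr_top tens0l.
transitivity (\sum_i \sum_k tens (top k) (t * rsubmx u 0 i * A e i k)).
  by apply: eq_bigr => i _; rewrite lbr_tens b_lbr.
rewrite exchange_big; apply: eq_bigr => k _.
have tsum m (d : 'I_m -> F) x : tens x (\sum_j d j) = \sum_j tens x (d j) :> L.
  by elim/big_rec2: _ => [|j y y' _ <-]; rewrite ?tens0r // tensDr.
by rewrite !mxE mulr_sumr tsum; apply: eq_bigr => i _; rewrite mulrA.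
Qed.

Lemma full_small i z :
  tT ^+ 2 * (mm z (full_basis i)).2 = 0 /\ (mm z (full_basis i)).1 * tT ^+ 2 = 0.
Proof.
rewrite /full_basis; case: split => // k; rewrite mm_top /= mul0r mulrA -exprD; split=> //.
by rewrite (_ : 2 + c.-1 = c + 1)%N ?exprD ?tT_nilp ?mul0r //; lia.
Qed.

Lemma full_orth i j z : (mm z (full_basis i)).1 * tT * (mm z (full_basis j)).2 = 0.
Proof.
rewrite /full_basis; case: split => // k; first by rewrite mm_top /= !mul0r.
case: split => // l; rewrite mm_top /= -mulrA [tT * _]mulrA -exprS.
by rewrite prednK ?tT_nilp ?mul0r ?mulr0 // ltnW.
Qed.

Lemma bch_alpha u v :
  bch p (alpha full_basis u) (alpha full_basis v) = alpha full_basis (u + v).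
Proof. by rewrite alphaD bch_orth //; apply: alpha_orth full_orth. Qed.

(** [character_count] is applied with S = F, t acting by conjugation by t x_e, where e depends on
    the central character. As |Z| = p^((c-1) f), the resulting N is at least (c - 1) f. *)
Lemma lower_core (C : numClosedFieldType) m (rho : L -> 'M[C]_m) :
  faithful_repr (@bch L p) rho -> (c.-1 * f * p ^ f <= m)%N.
Proof.
case=> rho_unit rhoM rho_inj.
pose R (u : 'rV[F]_(c.-1 + n)) := rho (alpha full_basis u).
have RD u v : R (u + v) = R u *m R v by rewrite /R -rhoM bch_alpha.
have R0 : R 0 = 1%:M.
  have := RD 0 0; rewrite addr0 => /(congr1 (mulmx (invmx (R 0)))).
  by rewrite mulmxA mulVmx ?mul1mx // rho_unit.
pose iz (z : 'rV[F]_c.-1) : 'rV[F]_(c.-1 + n) := row_mx z 0.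
have izD : {morph iz : z z' / z + z'} by move=> z z'; rewrite /iz add_row_mx addr0.
have aiz z : alpha full_basis (iz z) = alpha top z by rewrite alpha_full alpha0 addr0.
have iz_faithful z : R (iz z) = 1%:M -> z = 0.
  by rewrite -R0 => /rho_inj; rewrite aiz alpha0 => /alpha_top_inj.
have pU (u : 'rV[F]_(c.-1 + n)) : u *+ p = 0.
  by apply/rowP => i; rewrite mulmxnE mxE (mulrn_pchar pF).
have [|N [ZN Nm]] := @character_count C p m _ _ F R iz p_pr RD R0 pU izD iz_faithful.
  move=> chi chiD chi0 [z chiz].
  have chi01 : chi 0 = 1.
    by apply: (mulfI (chi0 0)); rewrite -chiD addr0 mulr1.
  have [k [s chis]] : exists k s, chi (s *: delta_mx 0 k) != 1.
    apply: contrapT => H; case/negP: chiz.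
    rewrite [z]row_sum_delta; elim/big_ind: _ => [|x y /eqP x1 /eqP y1|k _].
    - by rewrite chi01.
    - by rewrite chiD x1 y1 mulr1.
    - by apply: contraT => Hk; case: H; exists k, (z 0 k).
  have [e [w wE]] := A_cover k.
  exists (fun t => rho (tens (metab_gen c e) t)), (fun t u => t *: (rsubmx u *m A e)).
  split=> [t|t u|t z'|t t' tt'].
  - exact: rho_unit.
  - rewrite /R -!rhoM (bch_conj c2 pF cp); last 2 first.
    + exact: alpha_small full_small.
    + exact: alpha_orth full_orth.
    by rewrite lbr_alpha -aiz alphaD.
  - by rewrite /iz row_mxKr mul0mx scaler0.
  (* Scaled so that the central parts for t and t' differ by s times the k-th unit vector, where
     [chi] is nontrivial. *)
  exists (row_mx 0 ((s / (t - t')) *: w)); rewrite row_mxKr -scalemxAl wE !scalerA.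
  have -> : t * (s / (t - t')) = t' * (s / (t - t')) + s.
    have tt0 : t - t' != 0 by rewrite subr_eq0.
    by field.
  rewrite scalerDl chiD; apply: contraNneq chis => E; apply/eqP.
  by move: E; rewrite -[RHS]mulr1 => /(mulfI (chi0 _)).
apply: leq_trans Nm; rewrite cF leq_mul2r orbC.
move: ZN; rewrite card_mx mul1n cF -expnM leq_exp2l ?prime_gt1 //.
by rewrite mulnC => ->.
Qed.

End LowerCore.
End LowerCases.

(** For c >= 3, b consists of the monomials of degree c - 1: ad x1 takes b_j to top_j, ad x2 takes
    it to top_(j+1). For c = 2 that degree contains the generators, which do not commute, so b is x1
    alone. *)
Lemma lower_bound c p f (F : finFieldType) (C : numClosedFieldType) m
    (rho : tensor (free_metab_lie 2 c) F -> 'M[C]_m) :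
  (1 < c)%N -> p \in [pchar F] -> (c < p)%N -> #|F| = (p ^ f)%N ->
  faithful_repr (@bch (tensor (free_metab_lie 2 c) F) p) rho -> (c.-1 * f * p ^ f <= m)%N.
Proof.
move=> c2 pF cp cF.
have ordP (e : 'I_2) : e = ord0 \/ e = ord_max.
  by case: e => [[|[|//]] ?]; [left|right]; apply: val_inj.
have [cE|c_neq2] := eqVneq c 2%N.
  subst c; pose A (e : 'I_2) : 'M[F]_(1, 1) := if e == ord0 then 0 else const_mx (-1).
  apply: (lower_core c2 pF cp cF (b := fun=> metab_gen 2 ord0) (A := A)).
  - move=> i z; rewrite (model_x1 c2) /= mulr0 mul1r; split=> //; exact: (tT_nilp F c2).
  - by move=> i j z; rewrite (model_x1 c2) /= mulr0.
  - move=> e i s; rewrite big_ord1 /A; have [->|->] := ordP e; rewrite /= mxE.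
      by rewrite lbrxx tens0l mulr0 tens0r.
    rewrite lbrC tensNl mulrN1; apply/eqP; rewrite eq_sym -subr_eq0 opprK -tensDr addNr.
    by rewrite tens0r.
  (* The sign compensates [x2, x1] = - [x1, x2]. *)
  - move=> k; exists ord_max, (const_mx (-1)); apply/rowP => i.
    by rewrite /A /= !mxE big_ord1 !mxE !ord1 mulrNN mulr1.
have c3 : (2 < c)%N by lia.
pose b (j : 'I_c.-2) := mono c (c - 3 - j) j.
pose A (e : 'I_2) : 'M[F]_(c.-2, c.-1) :=
  \matrix_(j, k) (k == (if e == ord0 then val j else j.+1) :> nat)%:R.
have sum_top (k0 : 'I_c.-1) s :
    tens (top k0) s = \sum_k tens (top k) (s * (k == k0 :> nat)%:R : F).
  rewrite (bigD1 k0) //= eqxx mulr1 big1 ?addr0 // => k /negPf kk0.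
  by rewrite val_eqE kk0 mulr0 tens0r.
apply: (lower_core c2 pF cp cF (b := b) (A := A)).
- move=> i z; rewrite (model_mono c2) /= mul0r mulrA -exprD; split=> //.
  have := ltn_ord i => ic.
  by rewrite (_ : 2 + _ = c)%N ?(tT_nilp F c2) ?mul0r //; lia.
- by move=> i j z; rewrite !(model_mono c2) /= !mul0r.
- move=> e i s; have ic := ltn_ord i; have [->|->] := ordP e; rewrite /b.
    have ic1 : (i < c.-1)%N by lia.
    rewrite lbr_x1_mono; have -> : (c - 3 - i).+1 = (c.-2 - i)%N by lia.
    rewrite [LHS](sum_top (Ordinal ic1)); apply: eq_bigr => k _.
    by rewrite mxE.
  have ic1 : (i.+1 < c.-1)%N by lia.
  rewrite lbr_x2_mono; have -> : (c - 3 - i)%N = (c.-2 - i.+1)%N by lia.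
  rewrite [LHS](sum_top (Ordinal ic1)); apply: eq_bigr => k _.
  by rewrite mxE.
(* For k < c - 2, x1 reaches top_k from b_k; the last one, k = c - 2, is reached by x2 from
   b_(c-3). *)
- move=> k; have kc := ltn_ord k; case: (ltnP k c.-2) => kc2.
    exists ord0, (delta_mx 0 (Ordinal kc2)); rewrite -rowE; apply/rowP => l.
    by rewrite !mxE eqxx.
  have kc3 : (k.-1 < c.-2)%N by lia.
  exists ord_max, (delta_mx 0 (Ordinal kc3)); rewrite -rowE; apply/rowP => l.
  rewrite !mxE eqxx /= prednK //; lia.
Qed.

Theorem theorem2p15 (R : realType) (c p f : nat) (F : finFieldType)
    (hc : (2 <= c)%N) (hf : (1 <= f)%N) (hp : prime p) (hpc : (c < p)%N)
    (hF : #|F| = (p ^ f)%N) :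
  is_m_faithful R (@bch (tensor (free_metab_lie 2 c) F) p)
    ((c - 1) * f * p ^ f)%N.
Proof.
have pF : p \in [pchar F].
  have [q q_pr qF] := finPcharP F.
  have [n Fn] : exists n, #|F| = (q ^ n)%N.
    exact: (ex_intro _ _ (card_pprimeChar qF)).
  suff -> : p = q by [].
  apply/eqP; rewrite -dvdn_prime2 //.
  have : (p %| q ^ n)%N by rewrite -Fn hF dvdn_exp.
  by rewrite Euclid_dvdX // => /andP[].
split; first exact: (upper_bound hc pF hpc hF).
move=> m rho rhoF; rewrite subn1.
exact: (lower_bound (C := R[i]) hc pF hpc hF rhoF).
Qed.
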